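(* Assume that $\{P_t\}_{t\ge0}$ satisfies the weak Bakry-Émery condition ${\rm wBE}(\kappa_1,\kappa_2)$ with $0<\kappa_i<\beta_i$, $i=1,2$, and let $\Psi_1(t)=\sigma_{1-\frac{\kappa_1}{\beta_1},1-\frac{\kappa_2}{\beta_2}}(t)$. Then there exists $C>0$ such that for any $f\in\mathbf{B}^{1,\Psi_1}(X)$ $$\|f\|_{1,\Psi_1}\le C\liminf_{t\to0^+}\frac1{\Psi_1(t)}\int_XP_t(|f-f(y)|)(y)\,d\mu(y).$$
   Context: Notation: for $\alpha,\beta>0$, $\sigma_{\alpha,\beta}(x):=x^\alpha1_{[0,1]}(x)+x^\beta1_{(1,+\infty)}(x)$, $x\ge0$. Setting: $(X,d)$ is a locally compact complete metric space with open balls $B(x,r)=\{y:d(x,y)<r\}$, $\mu$ is a Radon measure, doubling and positive: there is $C>0$ with $0<\mu(B(x,2r))\le C\mu(B(x,r))<\infty$ for all $x\in X,r>0$. $(\mathcal E,\mathcal F)$ is a Dirichlet form on $L^2(X,\mu)$ with heat semigroup $\{P_t\}_{t\ge0}$, which is conservative ($P_t1=1$). Volume assumption: there are $\alpha_1,\alpha_2\ge1$ and $C>0$ with $C^{-1}\sigma_{\alpha_1,\alpha_2}(r)\le\mu(B(x,r))\le C\sigma_{\alpha_1,\alpha_2}(r)$ for all $x\in X,r>0$. Heat kernel assumption: $\{P_t\}$ has a heat kernel $p_t(x,y)$ (i.e. $P_tf(x)=\int_Xp_t(x,y)f(y)\,d\mu(y)$) and there are $\beta_1,\beta_2$ with $2\le\beta_i\le1+\alpha_i$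 ($i=1,2$) such that $p_t(x,y)$ is bounded above and below by expressions of the form $$\frac{C}{\sigma_{\alpha_1/\beta_1,\alpha_2/\beta_2}(t)}\exp\Big(-c\Big(\frac{d(x,y)^{\beta_1}}t\Big)^{\frac1{\beta_1-1}}\Big)\ \text{if } t<d(x,y),\qquad \frac{C}{\sigma_{\alpha_1/\beta_1,\alpha_2/\beta_2}(t)}\exp\Big(-c\Big(\frac{d(x,y)^{\beta_2}}t\Big)^{\frac1{\beta_2-1}}\Big)\ \text{if } t\ge d(x,y),$$ for $x,y\in X$, $t>0$, with positive constants $c,C$ that may differ in the upper and lower bounds. ${\rm wBE}(\kappa_1,\kappa_2)$: there is $C_{\rm wBE}>0$ with $|P_tf(x)-P_tf(y)|\le C_{\rm wBE}\frac{\sigma_{\kappa_1,\kappa_2}(d(x,y))}{\sigma_{\kappa_1/\beta_1,\kappa_2/\beta_2}(t)}\|f\|_{L^\infty}$ for all $x,y\in X$, $t>0$, $f\in L^\infty(X,\mu)$. Besov class: for non-decreasing $h:[0,\infty)\to[0,\infty)$ with $h(0)=0$ and $f\in L^1(X,\mu)$, $\|f\|_{1,h}:=\sup_{t>0}\frac1{h(t)}\int_XP_t(|f-f(y)|)(y)\,d\mu(y)$, where $P_t(|f-f(y)|)(y)=\int_X|f(x)-f(y)|p_t(y,x)\,d\mu(x)$, and $\mathbf{B}^{1,h}(X):=\{f\in L^1(X,\mu):\|f\|_{1,h}<\infty\}$. *)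

(* Defs.v *)
From HB Require Import structures.
From mathcomp Require Import all_boot all_order all_algebra.
From mathcomp Require Import all_classical all_reals all_analysis.

Set Implicit Arguments.
Unset Strict Implicit.
Unset Printing Implicit Defensive.
Import Order.TTheory GRing.Theory Num.Theory.
Import numFieldNormedType.Exports.

Local Open Scope classical_set_scope.
Local Open Scope ring_scope.

(* Complete metric spaces with distance [mdist], whose measurable sets are the
   Borel sets. *)
HB.mixin Record isBorel (d : measure_display) (T : Type)
    of Topological T & Measurable d T := {
  measurable_borel : @measurable d T = <<s @open T >>
}.

#[short(type="borelCompleteMetricType")]
HB.structure Definition BorelCompleteMetric (d : measure_display)
    (R : numDomainType) :=
  {T of Complete T & Metric R T & Measurable d T & isBorel d T}.

(* Only used at x >= 0; the first case is x in [0, 1]. *)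
Definition sigma (R : realType) (a b x : R) : R :=
  if x <= 1 then x `^ a else x `^ b.

Section measure.
Context d (R : realType) (X : borelCompleteMetricType d R).
Variable mu : {measure set X -> \bar R}.
Local Open Scope ereal_scope.

Definition radon_measure : Prop :=
  [/\ forall K : set X, compact K -> mu K < +oo,
      forall A : set X, measurable A ->
        mu A = ereal_inf [set mu U | U in [set U | open U /\ A `<=` U]] &
      forall U : set X, open U ->
        mu U = ereal_sup [set mu K | K in [set K | compact K /\ K `<=` U]]].

Definition doubling_positive : Prop :=
  exists2 C : R, (0 < C)%R & forall (x : X) (r : R), (0 < r)%R ->
    [/\ 0 < mu (ball x (2 * r)%R),
        mu (ball x (2 * r)%R) <= C%:E * mu (ball x r) &
        C%:E * mu (ball x r) < +oo].

Definition volume_growth (alpha1 alpha2 : R) : Prop :=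
  exists2 C : R, (0 < C)%R & forall (x : X) (r : R), (0 < r)%R ->
    (C^-1 * sigma alpha1 alpha2 r)%:E <= mu (ball x r) /\
    mu (ball x r) <= (C * sigma alpha1 alpha2 r)%:E.

End measure.

(* Elements of L^2 are handled through representatives: functions X -> R in
   [Lfun mu 2], up to mu-a.e. equality. *)
Section dirichlet_form.
Context d (R : realType) (X : borelCompleteMetricType d R).
Variable mu : {measure set X -> \bar R}.

Definition L2 : set (X -> R) := [set f | f \in Lfun mu 2%:E].

Definition L2dot (f g : X -> R) : R := \int[mu]_x (f x * g x).

Definition L2norm (f : X -> R) : R := fine ('N[mu]_2%:E[EFin \o f])%E.

Variables (E : (X -> R) -> (X -> R) -> R) (F : set (X -> R)).

Definition form1 (f g : X -> R) : R := E f g + L2dot f g.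

(* A densely defined, symmetric, nonnegative, closed, Markovian bilinear form
   on L^2; the second clause makes it a form on a.e.-classes. *)
Record dirichlet_form : Prop := DirichletForm {
  dform_L2 : F `<=` L2 ;
  dform_ae : forall f g, F f -> L2 g -> f = g %[ae mu] ->
    F g /\ forall h, F h -> E f h = E g h ;
  dform_dense : forall f, L2 f ->
    forall e, 0 < e -> exists2 g, F g & L2norm (f \- g) < e ;
  dform_domain : forall (a : R) f g, F f -> F g -> F (fun x => a * f x + g x) ;
  dform_linear : forall (a : R) f g h, F f -> F g -> F h ->
    E (fun x => a * f x + g x) h = a * E f h + E g h ;
  dform_sym : forall f g, F f -> F g -> E f g = E g f ;
  dform_ge0 : forall f, F f -> 0 <= E f f ;
  dform_closed : forall u : nat -> X -> R, (forall n, F (u n)) ->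
    (forall e, 0 < e -> exists N : nat, forall m n, (N <= m)%N -> (N <= n)%N ->
       form1 (u m \- u n) (u m \- u n) < e) ->
    exists2 f, F f & form1 (u n \- f) (u n \- f) @[n --> \oo] --> (0 : R) ;
  dform_markov : forall f, F f ->
    let g := fun x => Num.min (Num.max (f x) 0) 1 in F g /\ E g g <= E f f
}.

Variable P : R -> (X -> R) -> (X -> R).

(* [h] is the image of [f] under the L^2-generator of [P]. *)
Definition generator (f h : X -> R) : Prop :=
  L2norm (fun x => t^-1 * (P t f x - f x) - h x) @[t --> 0^'+] --> (0 : R).

(* [P] is the symmetric strongly continuous contraction semigroup on L^2 whose
   generator is the self-adjoint operator [L] associated with the form, i.e.
   [E f g = - <L f, g>] for every [g] in [F]. *)
Record heat_semigroup : Prop := HeatSemigroup {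
  heat_L2 : forall t f, 0 <= t -> L2 f -> L2 (P t f) ;
  heat_ae : forall t f g, 0 <= t -> L2 f -> L2 g ->
    f = g %[ae mu] -> P t f = P t g %[ae mu] ;
  heat_linear : forall t (a : R) f g, 0 <= t -> L2 f -> L2 g ->
    P t (fun x => a * f x + g x) = (fun x => a * P t f x + P t g x) %[ae mu] ;
  heat_contraction : forall t f, 0 <= t -> L2 f -> L2norm (P t f) <= L2norm f ;
  heat_sym : forall t f g, 0 <= t -> L2 f -> L2 g ->
    L2dot (P t f) g = L2dot f (P t g) ;
  heat_0 : forall f, L2 f -> P 0 f = f %[ae mu] ;
  heat_add : forall s t f, 0 <= s -> 0 <= t -> L2 f ->
    P (s + t) f = P s (P t f) %[ae mu] ;
  heat_cont : forall f, L2 f -> L2norm (P t f \- f) @[t --> 0^'+] --> (0 : R) ;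
  heat_generator : forall f h, L2 f -> L2 h ->
    generator f h <-> (F f /\ forall g, F g -> E f g = - L2dot h g)
}.

End dirichlet_form.

Section heat_kernel.
Context d (R : realType) (X : borelCompleteMetricType d R).
Variable mu : {measure set X -> \bar R}.
Variables (P : R -> (X -> R) -> (X -> R)) (p : R -> X -> X -> R).

(* The pointwise defined P_t f, also used for f outside L^2. *)
Definition heat_op (t : R) (f : X -> R) (x : X) : R :=
  \int[mu]_y (p t x y * f y).

Definition heat_kernel : Prop := forall t : R, 0 < t ->
  measurable_fun [set: X * X] (fun z => p t z.1 z.2) /\
  forall f, f \in Lfun mu 2%:E -> P t f = heat_op t f %[ae mu].

Definition conservative : Prop := forall t : R, 0 < t ->
  heat_op t (cst 1) = cst 1 %[ae mu].

Definition subgaussian (alpha1 alpha2 beta1 beta2 C c t r : R) : R :=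
  let beta := if t < r then beta1 else beta2 in
  C / sigma (alpha1 / beta1) (alpha2 / beta2) t *
  expR (- c * (r `^ beta / t) `^ (beta - 1)^-1).

Definition heat_kernel_estimates (alpha1 alpha2 beta1 beta2 : R) : Prop :=
  (exists C c : R, [/\ 0 < C, 0 < c & forall (x y : X) (t : R), 0 < t ->
     p t x y <= subgaussian alpha1 alpha2 beta1 beta2 C c t (mdist x y)]) /\
  (exists C c : R, [/\ 0 < C, 0 < c & forall (x y : X) (t : R), 0 < t ->
     subgaussian alpha1 alpha2 beta1 beta2 C c t (mdist x y) <= p t x y]).

Definition wBE (beta1 beta2 kappa1 kappa2 : R) : Prop :=
  exists2 C : R, 0 < C & forall (x y : X) (t : R) (f : X -> R), 0 < t ->
    f \in Lfun mu +oo%E ->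
    (`|heat_op t f x - heat_op t f y|%:E <=
     (C * (sigma kappa1 kappa2 (mdist x y) /
           sigma (kappa1 / beta1) (kappa2 / beta2) t))%:E *
     'N[mu]_+oo[EFin \o f])%E.

Local Open Scope ereal_scope.

(* (1 / h(t)) \int_X P_t(|f - f(y)|)(y) dmu(y), meant for nondecreasing
   h : [0, +oo) -> [0, +oo) with h(0) = 0; the integrals may be infinite. *)
Definition besov_quotient (h : R -> R) (f : X -> R) (t : R) : \bar R :=
  ((h t)^-1)%:E * \int[mu]_y \int[mu]_x (`|f x - f y| * p t y x)%:E.

Definition besov_seminorm (h : R -> R) (f : X -> R) : \bar R :=
  ereal_sup [set besov_quotient h f t | t in [set t | (0 < t)%R]].

Definition besov_class (h : R -> R) : set (X -> R) :=
  [set f | f \in Lfun mu 1 /\ besov_seminorm h f < +oo].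

End heat_kernel.

(* Main.v *)
Require Import Defs.
From HB Require Import structures.
From mathcomp Require Import all_boot all_order all_algebra.
From mathcomp Require Import all_classical all_reals all_analysis.
From mathcomp Require Import measurable_realfun ess_sup_inf.
From mathcomp Require Import ring lra.
Import Order.TTheory GRing.Theory Num.Theory.
Import numFieldNormedType.Exports.

(** The proof gives more than a bound by a lower limit: writing Q_t(f) for the
    Besov quotient at time t, there is C with Q_t(f) <= C Q_s(f) for all
    0 < s <= t and all f in L^1 ([besov_quotient_le]).

    Reduction to sets. By the coarea formula ([jump_coarea]) Q_t(f) is the integral
    over r of the quotients of the indicators of {f > r}. For r <> 0 this set or
    its complement has finite measure, so it suffices to treat the indicator of a
    set A of finite measure ([jump_scaling]). Up to a change of t by a bounded
    factor, the quotient is then comparable to J_t(A) / Psi(t), where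
    J_t(A) = <1_A - P_t 1_A, 1_A> is the mass that leaves A in time t
    ([crossingE]).

    Iteration. By the semigroup law and symmetry,
    J_(nt)(A) = sum_(k < n) <1_A - P_t 1_A, P_(kt) 1_A>, and each term is at most
    the integral of p_t(x,y) |u(x) - u(y)| over x in A, y outside A, with
    u = P_(kt) 1_A ([L2dot_heat_defect_le]). Put gamma_i = kappa_i / beta_i. For
    k >= 1 the weak Bakry-Emery condition gives |u(x) - u(y)| <= C sigma_kappa(d(x,y)) /
    sigma_gamma(kt), and the two-sided heat kernel estimates give
    p_t(x,y) sigma_kappa(d(x,y)) <= C sigma_gamma(t) p_(lt)(x,y) for a fixed large l
    ([subgaussian_compare]). So each term is at most
    C sigma_gamma(t) / sigma_gamma(kt) J_(lt)(A). Since sigma_gamma(t) Psi(t) = t and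
    Psi is up to constants the integral of 1 / sigma_gamma over [0, t]
    ([sum_inv_sigma_le]), summing over k yields
    J_(nt)(A) <= C Psi(nt) / Psi(t) J_(lt)(A) ([crossing_iter_le]). *)

Local Open Scope classical_set_scope.
Local Open Scope ring_scope.

(** * The two-scale power function *)

Section sigma_theory.
Context {R : realType}.
Implicit Types a b x y l m M : R.

(** Tangent-line bound for the concave function x^a; after division by u^a it
    is the weighted arithmetic-geometric mean inequality
    (v/u)^a 1^(1-a) <= a (v/u) + (1 - a). *)
Lemma powR_sub_ge a u v : 0 < a < 1 -> 0 <= v <= u -> 0 < u ->
  a * ((u - v) / u `^ (1 - a)) <= u `^ a - v `^ a.
Proof.
move=> /andP[a0 a1] /andP[v0 vu] u0.
have young : (v / u) `^ a <= v / u * a + 1 - a.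
  have q0 : 0 < (1 - a)^-1 by rewrite invr_gt0 subr_gt0.
  have ai0 : 0 < a^-1 by rewrite invr_gt0.
  have r0 : 0 <= v / u by rewrite divr_ge0 // ltW.
  have := @conjugate_powR _ ((v / u) `^ a) 1 a^-1 (1 - a)^-1 (powR_ge0 _ _)
    ler01 ai0 q0.
  rewrite !invrK -powRrM mulfV ?gt_eqF // powRr1 // powR1 mulr1 mul1r.
  rewrite [a + _]addrC subrK => /(_ erefl).
  by rewrite addrA.
have ua : u `^ (1 - a) = u / u `^ a.
  by rewrite powRB ?powRr1 ?ltW // gt_eqF ?implybT.
have ua0 : 0 < u `^ a by rewrite powR_gt0.
have -> : v `^ a = (v / u) `^ a * u `^ a.
  by rewrite -powRM ?divr_ge0 ?(ltW u0) // divfK // gt_eqF.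
rewrite ua.
have -> : a * ((u - v) / (u / u `^ a)) = a * (1 - v / u) * u `^ a.
  by field; rewrite !gt_eqF.
by rewrite -{2}[u `^ a]mul1r -mulrBl ler_pM2r //; nra.
Qed.

Lemma one_powR a : 1 `^ a = 1 :> R.
Proof. by rewrite powR1. Qed.

Lemma sigma_ge0 a b x : 0 <= sigma a b x.
Proof. by rewrite /sigma; case: ifP => _; exact: powR_ge0. Qed.

Lemma sigma_gt0 a b x : 0 < x -> 0 < sigma a b x.
Proof. by move=> x0; rewrite /sigma; case: ifP => _; exact: powR_gt0. Qed.

Lemma sigma_homo a b x y : 0 <= a -> 0 <= b -> 0 <= x -> x <= y ->
  sigma a b x <= sigma a b y.
Proof.
move=> a0 b0 x0 xy; rewrite /sigma.
have y0 : 0 <= y by exact: le_trans xy.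
case: ifPn => [x1|]; case: ifPn => [y1|].
- by rewrite ge0_ler_powR.
- rewrite -ltNge => y1; apply: (@le_trans _ _ 1).
    by rewrite -(one_powR a) ge0_ler_powR ?nnegrE.
  by rewrite -(one_powR b) ge0_ler_powR ?nnegrE // ltW.
- by rewrite -ltNge => x1; have := le_lt_trans y1 (lt_le_trans x1 xy); rewrite ltxx.
- by rewrite ge0_ler_powR.
Qed.

Lemma powR_le1_anti x a b : 0 <= x <= 1 -> 0 <= a -> a <= b ->
  x `^ b <= x `^ a.
Proof.
move=> /andP[x0 x1] a0 ab; move: x0; rewrite le_eqVlt => /predU1P[<-|x0].
  move: a0 ab; rewrite le_eqVlt => /predU1P[<-|a0] ab.
    by rewrite powRr0 /powR eqxx; case: (b == 0).
  by rewrite powR0 ?powR_ge0 // gt_eqF // (lt_le_trans a0).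
by rewrite ger_powR // x0.
Qed.

(** When x <= 1 < l x, the two sides use different exponents; comparing both with
    [M] works since (l x)^b <= (l x)^M, as l x > 1, and x^M <= x^a, as x <= 1. *)
Lemma sigma_scale_le a b M l x : 0 <= a <= M -> 0 <= b <= M -> 1 <= l ->
  0 <= x -> sigma a b (l * x) <= l `^ M * sigma a b x.
Proof.
move=> /andP[a0 aM] /andP[b0 bM] l1 x0; rewrite /sigma.
have l0 : 0 <= l by exact: le_trans l1.
case: ifPn => lx1; case: ifPn => x1.
- by rewrite powRM // ler_wpM2r ?powR_ge0 // ler_powR.
- by move: x1; rewrite -ltNge => x1; exfalso; nra.
- move: lx1; rewrite -ltNge => lx1.
  apply: (@le_trans _ _ ((l * x) `^ M)); first by rewrite ler_powR // ltW.
  by rewrite powRM // ler_wpM2l ?powR_ge0 // powR_le1_anti // x0.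
- by rewrite powRM // ler_wpM2r ?powR_ge0 // ler_powR.
Qed.

Lemma sigma_scale_ge a b m l x : 0 <= m -> m <= a -> m <= b -> 1 <= l ->
  0 <= x -> l `^ m * sigma a b x <= sigma a b (l * x).
Proof.
move=> m0 ma mb l1 x0; rewrite /sigma.
have l0 : 0 <= l by exact: le_trans l1.
case: ifPn => x1; case: ifPn => lx1.
- by rewrite powRM // ler_wpM2r ?powR_ge0 // ler_powR.
- move: lx1; rewrite -ltNge => lx1.
  apply: (@le_trans _ _ ((l * x) `^ m)); last by rewrite ler_powR // ltW.
  by rewrite powRM // ler_wpM2l ?powR_ge0 // powR_le1_anti // x0.
- by move: x1; rewrite -ltNge => x1; exfalso; nra.
- by rewrite powRM // ler_wpM2r ?powR_ge0 // ler_powR.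
Qed.

Lemma sigma_compl a b x : 0 <= x -> a < 1 -> b < 1 ->
  sigma a b x * sigma (1 - a) (1 - b) x = x.
Proof.
move=> x0 a1 b1; rewrite /sigma; case: ifPn => _.
  by rewrite -powRD ?(addrC a) ?subrK ?powRr1 // oner_eq0.
by rewrite -powRD ?(addrC b) ?subrK ?powRr1 // oner_eq0.
Qed.

(** Discrete form of Psi' >= m / sigma with Psi = sigma_(1-a,1-b). When the
    interval [v, u] contains the break point 1, it is split there, and both
    pieces are compared with the value of 1 / sigma at the right end. *)
Lemma sigma_sub_ge a b m u v : 0 < a < 1 -> 0 < b < 1 -> 0 <= m ->
    m <= 1 - a -> m <= 1 - b -> 0 <= v <= u -> 0 < u ->
  m * ((u - v) / sigma a b u) <= sigma (1 - a) (1 - b) u - sigma (1 - a) (1 - b) v.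
Proof.
move=> /andP[a0 a1] /andP[b0 b1] m0 ma mb /andP[v0 vu] u0; rewrite /sigma.
have uv0 : 0 <= u - v by rewrite subr_ge0.
have P c w z : 0 < c < 1 -> m <= 1 - c -> 0 <= w <= z -> 0 < z ->
    m * ((z - w) / z `^ c) <= z `^ (1 - c) - w `^ (1 - c).
  move=> /andP[c0 c1] mc wz z0; apply: (@le_trans _ _ ((1 - c) * ((z - w) / z `^ c))).
    rewrite ler_wpM2r // divr_ge0 ?powR_ge0 // subr_ge0; by case/andP: wz.
  have -> : z `^ c = z `^ (1 - (1 - c)) by congr (_ `^ _); ring.
  by apply: powR_sub_ge => //; lra.
case: ifPn => u1.
  by rewrite (le_trans vu u1); apply: P => //; rewrite ?a0 ?v0.
move: u1; rewrite -ltNge => u1.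
case: ifPn => v1; last by apply: P => //; rewrite ?b0 ?v0.
have h1 := P b 1 u _ mb _ u0.
have h2 := P a v 1 _ ma _ ltr01.
move: h1 h2; rewrite !powR1 b0 b1 a0 a1 v0 v1 divr1 ler01 (ltW u1).
move=> /(_ isT isT) h1 /(_ isT isT) h2.
apply: (@le_trans _ _ (m * ((u - 1) / u `^ b) + m * (1 - v))); last lra.
rewrite -mulrDr ler_wpM2l //.
have -> : u - v = (u - 1) + (1 - v) by ring.
rewrite mulrDl lerD2l ler_pdivrMr ?powR_gt0 // ler_peMr ?subr_ge0 //.
by rewrite -(powRr0 u) ler_powR // ltW.
Qed.

(** Riemann sum of the integral of 1 / sigma over [0, n t]. Its convergence at 0
    is where the exponents have to be smaller than 1. *)
Lemma sum_inv_sigma_le a b m t n : 0 < a < 1 -> 0 < b < 1 -> 0 < m ->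
    m <= 1 - a -> m <= 1 - b -> 0 < t ->
  \sum_(1 <= k < n.+1) (t / sigma a b (k%:R * t)) <=
    m^-1 * sigma (1 - a) (1 - b) (n%:R * t).
Proof.
move=> a01 b01 m0 ma mb t0; elim: n => [|n IH].
  by rewrite big_nil mulr_ge0 ?sigma_ge0 // invr_ge0 ltW.
rewrite big_nat_recr //=.
have h : m * (t / sigma a b (n.+1%:R * t)) <=
    sigma (1 - a) (1 - b) (n.+1%:R * t) - sigma (1 - a) (1 - b) (n%:R * t).
  have := @sigma_sub_ge a b m (n.+1%:R * t) (n%:R * t) a01 b01 (ltW m0) ma mb.
  rewrite -mulrBl -natrB ?leqnSn // subSnn mul1r; apply.
    by rewrite mulr_ge0 ?(ltW t0) // ler_wpM2r ?(ltW t0) // ler_nat leqnSn.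
  by rewrite mulr_gt0 // ltr0n.
rewrite -ler_pdivlMl // in h.
apply: (le_trans (lerD IH h)).
by rewrite mulrBr addrC subrK.
Qed.

End sigma_theory.

(** * Comparison of sub-Gaussian bounds *)

Section subgaussian_theory.
Context {R : realType} (alpha1 alpha2 beta1 beta2 : R).
Hypotheses (alpha1_gt0 : 0 < alpha1) (alpha2_gt0 : 0 < alpha2).
Hypotheses (beta1_gt1 : 1 < beta1) (beta2_gt1 : 1 < beta2).
Implicit Types r t : R.

Definition subgaussian_exponent t r : R :=
  let beta := if t < r then beta1 else beta2 in
  (r `^ beta / t) `^ (beta - 1)^-1.

Local Notation e := subgaussian_exponent.

Lemma subgaussian_exponent_ge0 t r : 0 <= e t r.
Proof. exact: powR_ge0. Qed.

Lemma subgaussianE C c t r : subgaussian alpha1 alpha2 beta1 beta2 C c t r =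
  C / sigma (alpha1 / beta1) (alpha2 / beta2) t * expR (- (c * e t r)).
Proof. by rewrite /subgaussian mulNr. Qed.

(** The exponent of a sub-Gaussian bound is r times a function of r / t alone,
    and that function is again of the form [sigma]: the break t = r of the
    two-regime bound is the break point 1 of r / t. *)
Lemma subgaussian_exponentE t r : 0 < t -> 0 <= r ->
  e t r = r * sigma (beta2 - 1)^-1 (beta1 - 1)^-1 (r / t).
Proof.
move=> t0 r0; rewrite /e /sigma ler_pdivrMr // mul1r.
have P b : 1 < b -> (r `^ b / t) `^ (b - 1)^-1 = r * (r / t) `^ (b - 1)^-1.
  move=> b1; have -> : r `^ b / t = r `^ (b - 1) * (r / t).
    by rewrite -(mulr_powRB1 r0 (lt_trans ltr01 b1)) mulrA [r * _]mulrC.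
  rewrite powRM ?powR_ge0 ?divr_ge0 // ?(ltW t0) // -powRrM.
  by rewrite mulfV ?powRr1 // subr_eq0 gt_eqF.
by case: leP => _; apply: P.
Qed.

(** In each regime the space-time ratio r^beta / t is recovered as a power of the
    exponent. *)
Lemma subgaussian_exponent_powR t r : 0 < t -> 0 <= r ->
  let beta := if t < r then beta1 else beta2 in
  (e t r) `^ (beta - 1) = r `^ beta / t.
Proof.
move=> t0 r0 beta; rewrite /e -/beta -powRrM mulVf ?powRr1 //.
  by rewrite divr_ge0 ?powR_ge0 // ltW.
by rewrite subr_eq0 gt_eqF // /beta; case: ifP.
Qed.

(** Polynomial factors in the space-time ratio are polynomially bounded by the
    exponent. The ratio uses the exponent beta1 or beta2 according to r <= 1
    while the sub-Gaussian exponent switches at t = r, whence four regimes. *)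
Lemma sigma_div_le_exponent t r : 0 < t -> 0 <= r ->
  sigma beta1 beta2 r / t <= (1 + e t r) `^ (beta1 + beta2).
Proof.
move=> t0 r0; have e0 := subgaussian_exponent_ge0 t r.
have e1 : 1 <= 1 + e t r by rewrite lerDl.
have le_pow c : 0 <= c -> c <= beta1 + beta2 ->
    e t r `^ c <= (1 + e t r) `^ (beta1 + beta2).
  move=> c0 cb; apply: (@le_trans _ _ ((1 + e t r) `^ c)).
    by rewrite ge0_ler_powR // ?nnegrE ?lerDr ?(le_trans ler01).
  by rewrite ler_powR.
have b1 := beta1_gt1; have b2 := beta2_gt1.
have := subgaussian_exponent_powR t r t0 r0; rewrite /sigma /=.
case: ltP => tr E; case: ifPn => r1.
- by rewrite -E; apply: le_pow; lra.
- move: r1; rewrite -ltNge => r1.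
  (* Mismatched regime t < r, r > 1: r^beta2 / t = r^(beta2 - 1) (r / t), where
     r <= e and r / t <= r^(beta1 - 1) (r / t) = e^(beta1 - 1). *)
  have re : r <= e t r.
    rewrite subgaussian_exponentE // ler_peMr //.
    have h : 1 < r / t by rewrite ltr_pdivlMr // mul1r.
    rewrite /sigma [r / t <= 1]leNgt h /= -[leLHS](powRr0 (r / t)) ler_powR ?(ltW h) //.
    by rewrite invr_ge0 subr_ge0 ltW.
  rewrite -(mulr_powRB1 r0 (lt_trans ltr01 b2)) mulrAC.
  apply: (@le_trans _ _ (e t r `^ (beta1 - 1) * e t r `^ (beta2 - 1))).
    apply: ler_pM; rewrite ?powR_ge0 //.
    + by rewrite divr_ge0 // ltW.
    + rewrite E ler_wpM2r ?invr_ge0 ?(ltW t0) //.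
      by rewrite le1r_powR // ltW.
    + by rewrite ge0_ler_powR // ?nnegrE ?subr_ge0 // ltW.
  have eg0 : 0 < e t r by exact: lt_le_trans (lt_trans ltr01 r1) re.
  rewrite -powRD; last by rewrite (gt_eqF eg0) implybT.
  by apply: le_pow; lra.
- have rt1 : r / t <= 1 by rewrite ler_pdivrMr // mul1r.
  apply: (@le_trans _ _ 1); last by rewrite -[leLHS](powRr0 (1 + e t r)) ler_powR //; lra.
  apply: le_trans rt1; rewrite ler_wpM2r ?invr_ge0 ?(ltW t0) //.
  by rewrite -{2}(powRr1 r0) powR_le1_anti ?r0 // ltW.
- by rewrite -E; apply: le_pow; lra.
Qed.

(** Since kappa = (kappa / beta) beta, the numerator is
    sigma_(kappa/beta)(w) with w = sigma_(beta1,beta2)(r), so that the ratio is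
    at most max (1, w / t). *)
Lemma sigma_ratio_le_exponent kappa1 kappa2 t r :
    0 < kappa1 < beta1 -> 0 < kappa2 < beta2 -> 0 < t -> 0 <= r ->
  sigma kappa1 kappa2 r / sigma (kappa1 / beta1) (kappa2 / beta2) t <=
  (1 + e t r) `^ (beta1 + beta2).
Proof.
move=> /andP[k10 k1b] /andP[k20 k2b] t0 r0.
have b1 := lt_trans ltr01 beta1_gt1; have b2 := lt_trans ltr01 beta2_gt1.
have g10 : 0 <= kappa1 / beta1 by rewrite divr_ge0 ?ltW.
have g20 : 0 <= kappa2 / beta2 by rewrite divr_ge0 ?ltW.
have g11 : kappa1 / beta1 <= 1 by rewrite ler_pdivrMr // mul1r ltW.
have g21 : kappa2 / beta2 <= 1 by rewrite ler_pdivrMr // mul1r ltW.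
have s0 := sigma_gt0 (kappa1 / beta1) (kappa2 / beta2) t t0.
set w := sigma beta1 beta2 r.
have w0 : 0 <= w by exact: sigma_ge0.
have -> : sigma kappa1 kappa2 r = sigma (kappa1 / beta1) (kappa2 / beta2) w.
  rewrite /w /sigma; case: ifPn => r1.
    have -> : r `^ beta1 <= 1.
      by rewrite -(one_powR beta1) ge0_ler_powR ?nnegrE ?(ltW b1).
    by rewrite -powRrM mulrC divfK // gt_eqF.
  have -> : (r `^ beta2 <= 1) = false.
    apply/negbTE; rewrite -ltNge -(one_powR beta2) gt0_ltr_powR ?nnegrE //.
    by rewrite ltNge.
  by rewrite -powRrM mulrC divfK // gt_eqF.
have [wt|tw] := leP w t.
  apply: (@le_trans _ _ 1).
    by rewrite ler_pdivrMr // mul1r sigma_homo.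
  rewrite -[leLHS](powRr0 (1 + e t r)) ler_powR ?lerDl ?subgaussian_exponent_ge0 //.
  by rewrite addr_ge0 // ltW.
apply: le_trans (sigma_div_le_exponent t r t0 r0); rewrite -/w.
have l1 : 1 <= w / t by rewrite ler_pdivlMr // mul1r ltW.
rewrite ler_pdivrMr //.
have := sigma_scale_le (kappa1 / beta1) (kappa2 / beta2) 1 (w / t) t.
rewrite g10 g11 g20 g21 => /(_ isT isT l1 (ltW t0)).
by rewrite divfK ?gt_eqF // powRr1 // (le_trans ler01).
Qed.

Lemma powR_le_expR (N c x : R) : 0 <= N -> 0 < c -> 0 <= x ->
  (1 + x) `^ N <= (Num.max 1 (N / c)) `^ N * expR (c * x).
Proof.
move=> N0 c0 x0; set M := Num.max 1 (N / c).
have M1 : 1 <= M by rewrite le_max lexx.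
have M0 : 0 < M by exact: lt_le_trans M1.
have h : 1 + x <= M * expR (x / M).
  apply: (@le_trans _ _ (M * (1 + x / M))).
    by rewrite mulrDr mulr1 mulrC divfK ?gt_eqF // lerD2r.
  by rewrite ler_pM2l // expR_ge1Dx.
apply: (@le_trans _ _ ((M * expR (x / M)) `^ N)).
  rewrite ge0_ler_powR // ?nnegrE ?addr_ge0 //.
  by rewrite mulr_ge0 ?(ltW M0) ?expR_ge0.
rewrite powRM ?(ltW M0) ?expR_ge0 // ler_wpM2l ?powR_ge0 //.
rewrite -expRM ler_expR mulrAC -mulrA [leRHS]mulrC ler_wpM2l //.
by rewrite ler_pdivrMr // mulrC -ler_pdivrMr // le_max lexx orbT.
Qed.

(** Multiplying time by a large factor [l] divides the exponent at least by a
    power of [l], so that the upper sub-Gaussian bound at time t is dominated by the lower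
    one at time t' >= l t, with half of the exponent to spare. The spare half
    absorbs the factor sigma_kappa(r) / sigma_(kappa/beta)(t), which is
    polynomial in the exponent. The range of t' has width proportional to t
    because later t' has to be a multiple of a prescribed small time. *)
Lemma subgaussian_compare (kappa1 kappa2 C1 c1 C2 c2 : R) :
    0 < kappa1 < beta1 -> 0 < kappa2 < beta2 ->
    0 < C1 -> 0 < c1 -> 0 < C2 -> 0 < c2 ->
  exists2 l : R, 1 <= l & exists2 C : R, 0 < C & forall t t' r,
    0 < t -> l * t <= t' <= 2 * l * t -> 0 <= r ->
    subgaussian alpha1 alpha2 beta1 beta2 C1 c1 t r *
      (1 + sigma kappa1 kappa2 r / sigma (kappa1 / beta1) (kappa2 / beta2) t) <=
    C * subgaussian alpha1 alpha2 beta1 beta2 C2 c2 t' r.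
Proof.
move=> k1 k2 C10 c10 C20 c20.
pose a := (beta1 - 1)^-1; pose b := (beta2 - 1)^-1.
have a0 : 0 < a by rewrite invr_gt0 subr_gt0.
have b0 : 0 < b by rewrite invr_gt0 subr_gt0.
pose m := Num.min a b.
have m0 : 0 < m by rewrite lt_min a0.
pose q := Num.max 1 (c2 / (c1 / 2)).
have q1 : 1 <= q by rewrite le_max lexx.
have q0 : 0 <= q by exact: le_trans q1.
(* [l] is chosen so that dividing the exponent by l^m turns c2 into at most c1 / 2. *)
pose l := q `^ m^-1.
have l1 : 1 <= l.
  by rewrite /l -[leLHS](powRr0 q) ler_powR // invr_ge0 ltW.
have lm : c2 <= c1 / 2 * l `^ m.
  rewrite /l -powRrM mulVf ?gt_eqF // powRr1 // mulrC -ler_pdivrMr ?divr_gt0 //.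
  by rewrite le_max lexx orbT.
have bb1 := lt_trans ltr01 beta1_gt1; have bb2 := lt_trans ltr01 beta2_gt1.
pose v1 := alpha1 / beta1; pose v2 := alpha2 / beta2.
have v10 : 0 < v1 by rewrite divr_gt0.
have v20 : 0 < v2 by rewrite divr_gt0.
pose V := v1 + v2.
pose N := beta1 + beta2.
have N0 : 0 <= N by rewrite addr_ge0 // ltW.
pose K := Num.max 1 (N / (c1 / 2)) `^ N.
have K0 : 0 < K by rewrite powR_gt0 // lt_max ltr01.
have l20 : 0 < 2 * l by rewrite mulr_gt0 // (lt_le_trans ltr01).
pose C := C1 * (2 * K) * (2 * l) `^ V / C2.
exists l => //; exists C.
  by rewrite /C !mulr_gt0 // ?invr_gt0 // powR_gt0.
move=> t t' r t0 /andP[ltt' t'lt] r0.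
have t'0 : 0 < t'.
  by apply: lt_le_trans ltt'; rewrite mulr_gt0 // (lt_le_trans ltr01).
have ltt : l <= t' / t by rewrite ler_pdivlMr.
have tt2 : t' / t <= 2 * l by rewrite ler_pdivrMr.
have tt1 : 1 <= t' / t by exact: le_trans ltt.
have tt0 : 0 <= t' / t by exact: le_trans tt1.
rewrite !subgaussianE -/v1 -/v2.
have e0 := subgaussian_exponent_ge0 t r.
have e'0 := subgaussian_exponent_ge0 t' r.
have exple : c2 * e t' r <= c1 / 2 * e t r.
  rewrite !subgaussian_exponentE // -/a -/b.
  have := sigma_scale_ge b a m (t' / t) (r / t') (ltW m0).
  rewrite /m !ge_min !lexx orbT /= -/m => /(_ isT isT tt1).
  rewrite divr_ge0 ?(ltW t'0) // => /(_ isT).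
  have -> : t' / t * (r / t') = r / t by field; rewrite !gt_eqF.
  move=> h.
  rewrite mulrCA [leRHS]mulrCA ler_wpM2l //.
  apply: (@le_trans _ _ (c1 / 2 * ((t' / t) `^ m * sigma b a (r / t')))).
    rewrite mulrA ler_wpM2r ?sigma_ge0 //; apply: (le_trans lm).
    rewrite ler_wpM2l ?divr_ge0 ?(ltW c10) //.
    by rewrite ge0_ler_powR ?(ltW m0) // ?nnegrE // (le_trans ler01).
  by rewrite ler_wpM2l ?divr_ge0 ?(ltW c10).
have volle : (sigma v1 v2 t)^-1 <= (2 * l) `^ V / sigma v1 v2 t'.
  have st0 := sigma_gt0 v1 v2 t t0; have st'0 := sigma_gt0 v1 v2 t' t'0.
  rewrite ler_pdivlMr // mulrC ler_pdivrMr //.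
  have h1 : 0 <= v1 <= V by rewrite /V lerDl !ltW.
  have h2 : 0 <= v2 <= V by rewrite /V lerDr !ltW.
  have := sigma_scale_le v1 v2 V (t' / t) t h1 h2 tt1 (ltW t0).
  rewrite divfK ?gt_eqF // => /le_trans; apply.
  rewrite ler_wpM2r ?(ltW st0) //.
  by rewrite ge0_ler_powR ?addr_ge0 ?nnegrE // ltW.
have facle : 1 + sigma kappa1 kappa2 r / sigma (kappa1 / beta1) (kappa2 / beta2) t
    <= 2 * K * expR (c1 / 2 * e t r).
  have h1 := sigma_ratio_le_exponent kappa1 kappa2 t r k1 k2 t0 r0.
  have c12 : 0 < c1 / 2 by rewrite divr_gt0.
  have h2 := powR_le_expR N (c1 / 2) (e t r) N0 c12 e0.
  have h3 : 1 <= (1 + e t r) `^ (beta1 + beta2).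
    by rewrite -[leLHS](powRr0 (1 + e t r)) ler_powR ?lerDl.
  rewrite -/K in h2; rewrite -mulrA mulr2n mulrDl mul1r.
  by apply: lerD; [exact: le_trans h2|apply: (le_trans h1)].
have s0 : 0 < (sigma v1 v2 t)^-1 by rewrite invr_gt0 sigma_gt0.
apply: (@le_trans _ _ (C1 * ((2 * l) `^ V / sigma v1 v2 t') *
    (expR (- (c1 * e t r)) * (2 * K * expR (c1 / 2 * e t r))))).
  rewrite -mulrA ler_pM ?mulr_ge0 ?expR_ge0 ?(ltW C10) ?(ltW s0) //.
  - by rewrite addr_ge0 // divr_ge0 // sigma_ge0.
  - by rewrite ler_wpM2l ?(ltW C10).
  - by rewrite ler_wpM2l ?expR_ge0.
have -> : expR (- (c1 * e t r)) * (2 * K * expR (c1 / 2 * e t r)) =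
    2 * K * expR (- (c1 / 2 * e t r)).
  by rewrite mulrCA -expRD; congr (_ * expR _); field.
have -> : C * (C2 / sigma v1 v2 t' * expR (- (c2 * e t' r))) =
    C1 * ((2 * l) `^ V / sigma v1 v2 t') * (2 * K * expR (- (c2 * e t' r))).
  by rewrite /C; field; rewrite !gt_eqF // sigma_gt0.
rewrite ler_wpM2l //.
  by rewrite !mulr_ge0 ?(ltW C10) ?powR_ge0 // invr_ge0 sigma_ge0.
by rewrite ler_wpM2l ?mulr_ge0 ?(ltW K0) // ler_expR lerN2.
Qed.

End subgaussian_theory.

(** * Square-integrable functions and probability densities *)

Section L2_theory.
Context {d : measure_display} {R : realType} {X : borelCompleteMetricType d R}.
Variable mu : {measure set X -> \bar R}.
Implicit Types (f g u : X -> R) (A : set X).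

Lemma L2_measurable f : L2 mu f -> measurable_fun setT f.
Proof. by rewrite /L2 /= inE => /andP[]; rewrite inE. Qed.

Lemma sqr_integrable_L2 f : measurable_fun setT f ->
  (\int[mu]_x (f x ^+ 2)%:E < +oo)%E -> L2 mu f.
Proof.
move=> mf foo; rewrite /L2 /= inE; apply/andP; split; rewrite inE //=.
rewrite /finite_norm unlock /Lnorm /=; apply: poweR_lty.
rewrite (eq_integral (fun x => (f x ^+ 2)%:E)) // => x _.
by rewrite powR_mulrn // real_normK // num_real.
Qed.

Lemma le_L2 f g : measurable_fun setT f -> (forall x, `|f x| <= `|g x|) ->
  L2 mu g -> L2 mu f.
Proof.
move=> mf fg L2g; apply: sqr_integrable_L2 => //.
have mg := L2_measurable g L2g.
apply: (@le_lt_trans _ _ (\int[mu]_x (g x ^+ 2)%:E)%E); last first.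
  exact: integrable_lty (Lfun2_integrable_sqr L2g).
apply: ge0_le_integral => //.
- by move=> x _; rewrite lee_fin sqr_ge0.
- by apply/measurable_EFinP; exact: measurable_funX.
- by apply/measurable_EFinP; exact: measurable_funX.
- move=> x _; rewrite lee_fin -(real_normK (num_real (f x))).
  by rewrite -(real_normK (num_real (g x))) lerXn2r ?nnegrE.
Qed.

Lemma indic_L2 A : measurable A -> (mu A < +oo)%E -> L2 mu \1_A.
Proof.
move=> mA Aoo; apply: sqr_integrable_L2 => //.
rewrite (eq_integral (fun x => (\1_A x)%:E)); last first.
  by move=> x _; rewrite indicE; case: (x \in A); rewrite /= ?expr1n ?expr0n.
by rewrite integral_indic // setIT.
Qed.

Lemma L2_mul_indic u A : measurable A -> L2 mu u ->
  L2 mu (fun x => u x * \1_A x).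
Proof.
move=> mA L2u; apply: (le_L2 _ _ _ _ L2u) => [|x].
  by apply: measurable_funM => //; exact: L2_measurable L2u.
rewrite normrM ler_piMr // indicE.
by case: (x \in A); rewrite ?normr1 ?normr0.
Qed.

Lemma integrable_L2dot f g : L2 mu f -> L2 mu g ->
  mu.-integrable setT (EFin \o (f \* g)).
Proof. by move=> L2f L2g; apply/Lfun1_integrable/Lfun2_mul_Lfun1. Qed.

Lemma L2dot_ae f f' g g' : L2 mu f -> L2 mu f' -> L2 mu g -> L2 mu g' ->
  f = f' %[ae mu] -> g = g' %[ae mu] -> L2dot mu f g = L2dot mu f' g'.
Proof.
move=> Lf Lf' Lg Lg' ff' gg'; rewrite /L2dot /Rintegral; congr fine.
apply: ae_eq_integral => //.
- exact: measurable_int (integrable_L2dot _ _ Lf Lg).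
- exact: measurable_int (integrable_L2dot _ _ Lf' Lg').
- by apply: filterS2 ff' gg' => x /(_ I) -> /(_ I) ->.
Qed.

(** [Rintegral] is the finite part of an extended integral, so the value 1
    excludes an infinite integral. *)
Lemma density_integrable (q : X -> R) : measurable_fun setT q ->
  (forall y, 0 <= q y) -> \int[mu]_y q y = 1 -> mu.-integrable setT (EFin \o q).
Proof.
move=> mq q0 q1; apply/integrableP; split; first exact/measurable_EFinP.
rewrite (eq_integral (EFin \o q)); last by move=> y _ /=; rewrite ger0_norm.
move: q1; rewrite /Rintegral /comp; case: (integral _ _ _) => [r|/=|/=] //.
  by move=> _; rewrite ltry.
by move/esym/eqP; rewrite oner_eq0.
Qed.

Lemma density_mul_indic_integrable (q : X -> R) E : measurable E ->
    measurable_fun setT q -> mu.-integrable setT (EFin \o q) ->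
  mu.-integrable setT (EFin \o (fun y => q y * \1_E y)).
Proof.
move=> mE mq iq; apply: le_integrable iq => //=.
  by apply/measurable_EFinP; apply: measurable_funM.
move=> y _; rewrite lee_fin normrM ler_piMr // indicE.
by case: (y \in E); rewrite ?normr1 ?normr0.
Qed.

Lemma integral_density_setC (q : X -> R) E (a : R) : measurable E ->
    measurable_fun setT q -> (forall y, 0 <= q y) -> \int[mu]_y q y = 1 ->
  (\int[mu]_y (a * (\1_(~` E) y * q y))%:E =
   (a * (1 - \int[mu]_y (q y * \1_E y)))%:E)%E.
Proof.
move=> mE mq q0 q1; have iq := density_integrable q mq q0 q1.
have iqE := density_mul_indic_integrable q E mE mq iq.
have iB : mu.-integrable setT (EFin \o (fun y => q y - q y * \1_E y)).
  by have := integrableB measurableT iq iqE.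
rewrite -q1 -RintegralB // -RintegralZl //.
have iZ : mu.-integrable setT (EFin \o (fun y => a * (q y - q y * \1_E y))).
  by have := integrableZl measurableT a iB.
rewrite /Rintegral fineK; last exact: integrable_fin_num.
apply: eq_integral => y _ /=; congr EFin; rewrite !indicE in_setC.
by case: (y \in E) => /=; ring.
Qed.

(** Both terms on the left are averages against the probability density [q] over
    the complement of [E], of the constant [c] and of [u]: the left-hand side is
    the integral of q (c - u) over that complement. *)
Lemma density_defect_le (q q' u : X -> R) E (c K : R) : measurable E ->
    measurable_fun setT q -> measurable_fun setT q' -> measurable_fun setT u ->
    (forall y, 0 <= q y) -> (forall y, 0 <= K * q' y) ->
    \int[mu]_y q y = 1 -> {ae mu, forall y, `|u y| <= 1} ->
    {ae mu, forall y, q y * `|c - u y| <= K * q' y} ->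
  (`|c * (1 - \int[mu]_y (q y * \1_E y)) -
     \int[mu]_y (q y * (u y * \1_(~` E) y))|%:E <=
   \int[mu]_y (\1_(~` E) y * (K * q' y))%:E)%E.
Proof.
move=> mE mq mq' mu_u q0 Kq'0 q1 u1 quK.
have mEc : measurable (~` E) by exact: measurableC.
have iq := density_integrable q mq q0 q1.
have iqE := density_mul_indic_integrable q E mE mq iq.
have mquE : measurable_fun setT (fun y => q y * (u y * \1_(~` E) y)).
  by do 2 apply: measurable_funM => //.
have iquE : mu.-integrable setT (EFin \o (fun y => q y * (u y * \1_(~` E) y))).
  apply/integrableP; split; first exact/measurable_EFinP.
  apply: le_lt_trans (integrable_lty measurableT iq).
  apply: ae_ge0_le_integral => //.
  - by apply/measurable_EFinP/measurableT_comp.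
  - by move=> y _; rewrite lee_fin.
  - exact/measurable_EFinP.
  apply: filterS u1 => y uy _ /=; rewrite lee_fin normrM ger0_norm // ler_piMr //.
  rewrite normrM indicE; case: (y \in _); rewrite ?normr1 ?mulr1 //.
  by rewrite normr0 mulr0.
have -> : c * (1 - \int[mu]_y (q y * \1_E y)) -
     \int[mu]_y (q y * (u y * \1_(~` E) y)) =
     \int[mu]_y (\1_(~` E) y * (q y * (c - u y))).
  have iB : mu.-integrable setT (EFin \o (fun y => q y - q y * \1_E y)).
    by have := integrableB measurableT iq iqE.
  rewrite -q1 -RintegralB // -RintegralZl // -RintegralB //; last first.
    by have := integrableZl measurableT c iB.
  apply: eq_Rintegral => y _; rewrite !indicE in_setC.
  by case: (y \in E) => /=; ring.
rewrite EFin_normr_Rintegral //; last first.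
  have -> : EFin \o (fun y => \1_(~` E) y * (q y * (c - u y))) =
      (fun y => c%:E * (q y - q y * \1_E y)%R%:E -
      (q y * (u y * \1_(~` E) y))%R%:E)%E.
    apply/funext => y /=; rewrite -EFinM -EFinB !indicE in_setC.
    by congr EFin; case: (y \in E) => /=; ring.
  apply: integrableB => //; apply: integrableZl => //.
  by have := integrableB measurableT iq iqE.
have mlhs : measurable_fun setT (fun y => \1_(~` E) y * (q y * (c - u y))).
  apply: measurable_funM => //; apply: measurable_funM => //.
  exact: measurable_funB.
apply: le_trans (le_abse_integral _ _ _) _ => //.
  exact/measurable_EFinP.
apply: ae_ge0_le_integral => //.
- by apply/measurable_EFinP; exact: measurableT_comp.
- by move=> y _; rewrite lee_fin mulr_ge0 ?indicE.
- apply/measurable_EFinP; apply: measurable_funM => //.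
  exact: measurable_funM.
apply: filterS quK => y qy _ /=; rewrite lee_fin normrM.
rewrite (ger0_norm (_ : 0 <= \1_(~` E) y)); last by rewrite indicE.
rewrite ler_wpM2l ?indicE //.
by rewrite normrM ger0_norm.
Qed.

End L2_theory.

(** * The mass crossing the boundary of a set *)

(** The mass that the kernel moves out of [A] in time [t]. *)
Definition crossing {d : measure_display} {R : realType}
    {X : borelCompleteMetricType d R}
    (mu : {measure set X -> \bar R}) (p : R -> X -> X -> R) (t : R)
    (A : set X) : \bar R :=
  (\int[mu]_x \int[mu]_y (\1_A x * (\1_(~` A) y * p t x y))%:E)%E.

Section measurable_crossing.
Context {R : realType} {d : measure_display} {X : borelCompleteMetricType d R}.
Variable mu : {sigma_finite_measure set X -> \bar R}.
Variable p : R -> X -> X -> R.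
Hypothesis mp : forall t, 0 < t ->
  measurable_fun [set: X * X] (fun z => p t z.1 z.2).
Hypothesis p_ge0 : forall t x y, 0 < t -> 0 <= p t x y.
Implicit Types (t : R) (A : set X).

Lemma measurable_crossing t A : 0 < t -> measurable A ->
  measurable_fun [set: X * X]
    (fun z => (\1_A z.1 * (\1_(~` A) z.2 * p t z.1 z.2))%:E).
Proof.
move=> t0 mA; apply/measurable_EFinP.
apply: measurable_funM; last apply: measurable_funM.
- exact: measurableT_comp.
- by apply: measurableT_comp => //; apply: measurable_indic; exact: measurableC.
- exact: mp.
Qed.

Lemma crossing_integrand_ge0 t A (z : X * X) : 0 < t ->
  (0 <= (\1_A z.1 * (\1_(~` A) z.2 * p t z.1 z.2))%:E)%E.
Proof. by move=> t0; rewrite lee_fin !mulr_ge0 ?p_ge0 // indicE. Qed.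

Lemma measurable_crossing_section t A : 0 < t -> measurable A ->
  measurable_fun setT
    (fun x => \int[mu]_y (\1_A x * (\1_(~` A) y * p t x y))%:E)%E.
Proof.
move=> t0 mA.
apply: (measurable_fun_fubini_tonelli_F (m2 := mu) _ (measurable_crossing t A t0 mA)).
by move=> z; exact: crossing_integrand_ge0.
Qed.

End measurable_crossing.

Section crossing_theory.
Context {R : realType} {d : measure_display} {X : borelCompleteMetricType d R}.
Variable mu : {sigma_finite_measure set X -> \bar R}.
Variables (E : (X -> R) -> (X -> R) -> R) (F : set (X -> R)).
Variables (P : R -> (X -> R) -> (X -> R)) (p : R -> X -> X -> R).
Hypothesis hP : heat_semigroup mu E F P.
Hypothesis hp : heat_kernel mu P p.
Hypothesis p_conservative : conservative mu p.
Hypothesis p_ge0 : forall t x y, 0 < t -> 0 <= p t x y.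
Implicit Types (t : R) (A : set X).

Let p1 t : 0 < t -> {ae mu, forall x, \int[mu]_y p t x y = 1}.
Proof.
move=> t0; apply: filterS (p_conservative t t0) => x /(_ I); rewrite /heat_op /= => <-.
by apply: eq_Rintegral => y _; rewrite mulr1.
Qed.

Lemma measurable_heat_kernel t : 0 < t ->
  measurable_fun [set: X * X] (fun z => p t z.1 z.2).
Proof. by move=> t0; have [] := hp t t0. Qed.

Lemma measurable_heat_kernel_section t x : 0 < t -> measurable_fun setT (p t x).
Proof.
move=> t0; exact: (measurableT_comp (measurable_heat_kernel t t0)
  (pair1_measurable x)).
Qed.

Let heat_L2' t f : 0 <= t -> L2 mu f -> L2 mu (P t f).
Proof. exact: (heat_L2 hP). Qed.

Let heat_opE t f : 0 < t -> L2 mu f -> P t f = heat_op mu p t f %[ae mu].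
Proof. by move=> t0 Lf; have [_] := hp t t0; apply. Qed.

(** By conservativeness the mass that stays in [A] and the mass that leaves it add
    up to the measure of [A]. *)
Lemma crossingE t A : 0 < t -> measurable A -> (mu A < +oo)%E ->
  crossing mu p t A = (L2dot mu \1_A \1_A - L2dot mu (P t \1_A) \1_A)%:E.
Proof.
move=> t0 mA Aoo.
have Lf : L2 mu \1_A by exact: indic_L2.
have LPf : L2 mu (P t \1_A) by apply: heat_L2'; rewrite // ltW.
have iff := integrable_L2dot _ _ _ Lf Lf.
have iPf := integrable_L2dot _ _ _ LPf Lf.
have iB : mu.-integrable setT
    (EFin \o (fun x => \1_A x * \1_A x - P t \1_A x * \1_A x)).
  by have := integrableB measurableT iff iPf.
rewrite /L2dot -RintegralB // /Rintegral fineK; last exact: integrable_fin_num.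
rewrite /crossing; apply: ae_eq_integral => //.
- exact: (measurable_crossing_section mu p measurable_heat_kernel p_ge0).
- exact: measurable_int iB.
apply: filterS2 (p1 t t0) (heat_opE t \1_A t0 Lf) => x px /(_ I) Pf _.
rewrite integral_density_setC //; last 2 first.
- exact: measurable_heat_kernel_section.
- by move=> y; exact: p_ge0.
congr EFin; rewrite Pf /heat_op !indicE.
by case: (x \in A) => /=; ring.
Qed.

(** Formally the left-hand side is the integral of p_t(x,y) (1_A(x) - 1_A(y)) u(x),
    and symmetrizing turns it into the integral of p_t(x,y) (u(x) - u(y)) over
    x in A, y outside A. The symmetry of the kernel enters only through that of
    the semigroup, applied to 1_A and to the part of [u] outside [A]. The
    increment of [u] may then be bounded pointwise, which avoids integrating
    functions of the distance, whose joint measurability is not clear. *)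
Lemma L2dot_heat_defect_le t t' A u K : 0 < t -> 0 < t' -> measurable A ->
    (mu A < +oo)%E -> L2 mu u -> {ae mu, forall x, `|u x| <= 1} -> 0 <= K ->
    {ae mu, forall x, {ae mu, forall y,
      p t x y * `|u x - u y| <= K * p t' x y}} ->
  ((L2dot mu \1_A u - L2dot mu (P t \1_A) u)%:E <= K%:E * crossing mu p t' A)%E.
Proof.
move=> t0 t'0 mA Aoo Lu u1 K0 hK.
have mAc : measurable (~` A) by exact: measurableC.
have Lf : L2 mu \1_A by exact: indic_L2.
have LPf : L2 mu (P t \1_A) by apply: heat_L2'; rewrite // ltW.
pose w := (fun x => u x * \1_A x); pose v := (fun x => u x * \1_(~` A) x).
have Lw : L2 mu w by exact: L2_mul_indic.
have Lv : L2 mu v by exact: L2_mul_indic.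
have LPv : L2 mu (P t v) by apply: heat_L2'; rewrite // ltW.
have ifu := integrable_L2dot _ _ _ Lf Lu.
have iPw := integrable_L2dot _ _ _ LPf Lw.
have iPv := integrable_L2dot _ _ _ LPf Lv.
have ifv := integrable_L2dot _ _ _ Lf LPv.
pose g x := \1_A x * u x - (P t \1_A x * w x + \1_A x * P t v x).
have ig : mu.-integrable setT (EFin \o g).
  by have := integrableB measurableT ifu (integrableD measurableT iPw ifv).
have -> : L2dot mu \1_A u - L2dot mu (P t \1_A) u = \int[mu]_x g x.
  have -> : L2dot mu (P t \1_A) u = L2dot mu (P t \1_A) w + L2dot mu (P t \1_A) v.
    rewrite /L2dot -RintegralD //; apply: eq_Rintegral => x _.
    by rewrite /w /v !indicE in_setC; case: (x \in A) => /=; ring.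
  rewrite (heat_sym hP (ltW t0) Lf Lv) /g RintegralB //; last first.
    by have := integrableD measurableT iPw ifv.
  by rewrite RintegralD.
apply: (@le_trans _ _ (`|\int[mu]_x g x|%:E)%E); first by rewrite lee_fin ler_norm.
rewrite EFin_normr_Rintegral //.
apply: le_trans (le_abse_integral _ _ _) _ => //; first exact: measurable_int ig.
have mc := measurable_crossing_section mu p measurable_heat_kernel p_ge0 t' A t'0 mA.
rewrite /crossing -ge0_integralZl //; last first.
  by move=> x _; apply: integral_ge0 => y _; exact: (crossing_integrand_ge0 p p_ge0 t' A (x, y)).
apply: ae_ge0_le_integral => //.
- by apply: measurableT_comp => //; exact: measurable_int ig.
- move=> x _; apply: mule_ge0; rewrite ?lee_fin //.
  by apply: integral_ge0 => y _; exact: (crossing_integrand_ge0 p p_ge0 t' A (x, y)).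
- exact: measurable_funeM.
have hPf := heat_opE t _ t0 Lf; have hPv := heat_opE t _ t0 Lv.
have hall : {ae mu, forall x, [/\ \int[mu]_y p t x y = 1,
    P t \1_A x = heat_op mu p t \1_A x, P t v x = heat_op mu p t v x &
    {ae mu, forall y, p t x y * `|u x - u y| <= K * p t' x y}]}.
  near=> x; split.
  - by near: x; exact: p1.
  - by near: x; apply: filterS hPf => x; apply.
  - by near: x; apply: filterS hPv => x; apply.
  - by near: x.
apply: filterS hall => x [px Pfx Pvx hx] _.
have -> : g x = \1_A x * (u x * (1 - heat_op mu p t \1_A x) - heat_op mu p t v x).
  by rewrite /g Pfx Pvx /w; case: (x \in A) (indicE R A x) => -> /=; ring.
have mp := measurable_heat_kernel_section t x t0.
have mp' := measurable_heat_kernel_section t' x t'0.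
have := density_defect_le mu (p t x) (p t' x) u A (u x) K mA mp mp'
  (L2_measurable mu u Lu) (fun y => p_ge0 t x y t0)
  (fun y => mulr_ge0 K0 (p_ge0 t' x y t'0)) px u1 hx.
rewrite -/(heat_op mu p t \1_A x) -/(heat_op mu p t v x) => hkd.
have -> : (K%:E * \int[mu]_y (\1_A x * (\1_(~` A) y * p t' x y))%:E =
    \int[mu]_y (\1_A x * (\1_(~` A) y * (K * p t' x y)))%:E)%E.
  rewrite -ge0_integralZl //.
  - by apply: eq_integral => y _; rewrite -EFinM; congr EFin; ring.
  - apply/measurable_EFinP; apply: measurable_funM => //.
    exact: measurable_funM.
  - by move=> y _; exact: (crossing_integrand_ge0 p p_ge0 t' A (x, y)).
rewrite abse_EFin normrM indicE.
case: (x \in A) => /=.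
  rewrite normr1 mul1r; apply: (le_trans hkd).
  by under [leRHS]eq_integral do rewrite mul1r.
rewrite normr0 mul0r; apply: integral_ge0 => y _.
by rewrite lee_fin mul0r.
Unshelve. all: by end_near. Qed.

End crossing_theory.

(** * Iteration of the crossing estimate *)

Lemma indic_Linf {d : measure_display} {R : realType}
    {X : borelCompleteMetricType d R} (mu : {measure set X -> \bar R}) A :
  measurable A ->
  \1_A \in Lfun mu +oo%E /\ ('N[mu]_+oo[EFin \o \1_A] <= 1)%E.
Proof.
move=> mA.
have N1 : ('N[mu]_+oo[EFin \o \1_A] <= 1)%E.
  rewrite unlock /Lnorm; case: ifPn => _; last exact: lee01.
  apply/ess_supP; apply: nearW => x /=; rewrite lee_fin indicE.
  by case: (x \in A); rewrite ?normr1 ?normr0.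
split => //; rewrite inE; apply/andP; split; rewrite inE /=.
  exact: measurable_indic.
by rewrite /finite_norm (le_lt_trans N1) // ltry.
Qed.

Section crossing_iteration.
Context {R : realType} {d : measure_display} {X : borelCompleteMetricType d R}.
Variable mu : {sigma_finite_measure set X -> \bar R}.
Variables (E : (X -> R) -> (X -> R) -> R) (F : set (X -> R)).
Variables (P : R -> (X -> R) -> (X -> R)) (p : R -> X -> X -> R).
Hypothesis hP : heat_semigroup mu E F P.
Hypothesis hp : heat_kernel mu P p.
Hypothesis p_conservative : conservative mu p.
Hypothesis p_ge0 : forall t x y, 0 < t -> 0 <= p t x y.
Implicit Types (t : R) (A : set X).

(** The semigroup law and symmetry: with u = P_(kt) f,
    <P_(kt) f, f> - <P_(kt) P_t f, f> = <f - P_t f, u>. *)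
Lemma L2dot_heat_telescope t f k : 0 <= t -> L2 mu f ->
  L2dot mu (P (k%:R * t) f) f - L2dot mu (P (k.+1%:R * t) f) f =
  L2dot mu f (P (k%:R * t) f) - L2dot mu (P t f) (P (k%:R * t) f).
Proof.
move=> t0 Lf.
have kt0 : 0 <= k%:R * t by rewrite mulr_ge0.
have k1t0 : 0 <= k.+1%:R * t by rewrite mulr_ge0.
have Lt := heat_L2 hP t0 Lf; have Lk := heat_L2 hP kt0 Lf.
have Lk1 := heat_L2 hP k1t0 Lf.
rewrite (heat_sym hP kt0 Lf Lf); congr (_ - _).
rewrite -(heat_sym hP kt0 Lt Lf).
have -> : k.+1%:R * t = k%:R * t + t by rewrite -natr1 mulrDl mul1r.
apply: L2dot_ae => //.
- by apply: (heat_L2 hP) => //; rewrite addr_ge0.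
- exact: (heat_L2 hP).
- exact: (heat_add hP).
- by apply: nearW.
Qed.

Lemma heat_op_indic_le1 t A : 0 < t -> measurable A ->
  {ae mu, forall x, `|heat_op mu p t \1_A x| <= 1}.
Proof.
move=> t0 mA; apply: filterS (p_conservative t t0) => x /(_ I).
rewrite /heat_op /= => px.
have mp : measurable_fun setT (p t x) by exact: (measurable_heat_kernel_section mu P p hp).
have q1 : \int[mu]_y p t x y = 1.
  by rewrite -px; apply: eq_Rintegral => y _; rewrite mulr1.
have q0 y : 0 <= p t x y by exact: p_ge0.
have iq := density_integrable mu (p t x) mp q0 q1.
have iqA := density_mul_indic_integrable mu (p t x) A mA mp iq.
have pA0 y : 0 <= p t x y * \1_A y by rewrite mulr_ge0 // indicE.
rewrite ger0_norm; last by apply: Rintegral_ge0 => y _.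
rewrite -q1; apply: le_Rintegral => // y _.
by rewrite ler_piMr // indicE; case: (y \in A).
Qed.

Variables (beta1 beta2 kappa1 kappa2 m Cw : R).
Local Notation gamma1 := (kappa1 / beta1).
Local Notation gamma2 := (kappa2 / beta2).
Hypotheses (gamma1_01 : 0 < gamma1 < 1) (gamma2_01 : 0 < gamma2 < 1).
Hypotheses (m_gt0 : 0 < m) (m_le1 : m <= 1 - gamma1) (m_le2 : m <= 1 - gamma2).
Hypothesis Cw_gt0 : 0 < Cw.
Hypothesis hwBE : forall x y t f, 0 < t -> f \in Lfun mu +oo%E ->
  (`|heat_op mu p t f x - heat_op mu p t f y|%:E <=
     (Cw * (sigma kappa1 kappa2 (mdist x y) / sigma gamma1 gamma2 t))%:E *
     'N[mu]_+oo[EFin \o f])%E.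

(** The heart of the argument. The mass leaving [A] up to time n t is the sum over
    k < n of <1_A - P_t 1_A, P_(kt) 1_A>. For k >= 1 the weak Bakry-Emery
    condition bounds the increments of P_(kt) 1_A by
    sigma_kappa(d(x,y)) / sigma_gamma(kt), and the kernel comparison trades
    p_t(x,y) sigma_kappa(d(x,y)) for sigma_gamma(t) p_t'(x,y). What remains is the
    sum of sigma_gamma(t) / sigma_gamma(kt), a Riemann sum of size
    Psi(n t) / Psi(t), because sigma_gamma(t) Psi(t) = t. *)
Lemma crossing_iter_le t t' C0 A n : 0 < t -> 0 < t' -> 0 < C0 ->
    (forall x y, p t x y *
       (1 + sigma kappa1 kappa2 (mdist x y) / sigma gamma1 gamma2 t) <=
       C0 * p t' x y) ->
    measurable A -> (mu A < +oo)%E -> (0 < n)%N ->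
  (crossing mu p (n%:R * t) A <=
   (2 * (C0 * (1 + Cw)) / m *
     (sigma (1 - gamma1) (1 - gamma2) (n%:R * t) /
      sigma (1 - gamma1) (1 - gamma2) t))%:E * crossing mu p t' A)%E.
Proof.
move=> t0 t'0 C00 hk mA Aoo n0.
have Lf : L2 mu \1_A by exact: indic_L2.
have sg := sigma_gt0 gamma1 gamma2.
pose D := C0 * (1 + Cw).
have D0 : 0 < D by rewrite mulr_gt0 // addr_gt0.
have crE s : 0 < s -> crossing mu p s A = (L2dot mu \1_A \1_A - L2dot mu (P s \1_A) \1_A)%:E.
  by move=> s0; exact: (crossingE mu E F P p hP hp).
pose j := L2dot mu \1_A \1_A - L2dot mu (P t' \1_A) \1_A.
have j0 : 0 <= j.
  rewrite -lee_fin -crE // /crossing; apply: integral_ge0 => x _.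
  by apply: integral_ge0 => y _; rewrite lee_fin !mulr_ge0 ?p_ge0 // indicE.
have pC0 x y : p t x y <= C0 * p t' x y.
  apply: le_trans (hk x y); rewrite ler_peMr ?p_ge0 // lerDl.
  by rewrite divr_ge0 ?sigma_ge0.
pose a k := L2dot mu (P (k%:R * t) \1_A) \1_A.
(* [maxn k 1] gives the term k = 0, where no smoothing is available; the
   bound 1 on the increments leads to the same estimate as for k = 1. *)
pose S k := D * (sigma gamma1 gamma2 t / sigma gamma1 gamma2 ((maxn k 1)%:R * t)).
have S0 k : 0 <= S k by rewrite mulr_ge0 ?(ltW D0) // divr_ge0 ?sigma_ge0.
have step k : a k - a k.+1 <= S k * j.
  rewrite /a L2dot_heat_telescope ?(ltW t0) // -lee_fin EFinM.
  rewrite /j -crE //.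
  have kt0 : 0 <= k%:R * t by rewrite mulr_ge0 // ltW.
  apply: (L2dot_heat_defect_le mu E F P p hP hp) => //.
  - exact: (heat_L2 hP).
  - case: k kt0 => [|k] kt0.
      rewrite mul0r; apply: filterS (heat_0 hP Lf) => x /(_ I) ->.
      by rewrite indicE; case: (x \in A); rewrite ?normr1 ?normr0.
    have k1t0 : 0 < k.+1%:R * t by rewrite mulr_gt0.
    have [_ hE] := hp _ k1t0.
    by apply: filterS2 (heat_op_indic_le1 _ _ k1t0 mA) (hE _ Lf) => x ? /(_ I) ->.
  - case: k kt0 => [|k] kt0.
      rewrite mul0r; have h0 := heat_0 hP Lf.
      apply: filterS (h0) => x /(_ I) ->.
      apply: filterS (h0) => y /(_ I) ->.
      apply: (@le_trans _ _ (p t x y)).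
        rewrite ler_piMr ?p_ge0 // !indicE.
        by case: (x \in A); case: (y \in A);
          rewrite ?subrr ?subr0 ?sub0r ?normrN ?normr1 ?normr0.
      apply: (le_trans (pC0 x y)).
      rewrite /S mul1r divff ?gt_eqF ?sg // mulr1 ler_wpM2r ?p_ge0 //.
      by rewrite /D ler_peMr ?(ltW C00) // lerDl ltW.
    have k1t0 : 0 < k.+1%:R * t by rewrite mulr_gt0.
    have [_ /(_ _ Lf) hE] := hp _ k1t0.
    apply: filterS (hE) => x /(_ I) ->.
    apply: filterS (hE) => y /(_ I) ->.
    have [Li N1] := indic_Linf mu A mA.
    set s := sigma kappa1 kappa2 (mdist x y).
    have s0 : 0 <= s by exact: sigma_ge0.
    have hb : `|heat_op mu p (k.+1%:R * t) \1_A x - heat_op mu p (k.+1%:R * t) \1_A y|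
        <= Cw * (s / sigma gamma1 gamma2 (k.+1%:R * t)).
      rewrite -lee_fin; apply: (le_trans (hwBE x y _ _ k1t0 Li)).
      rewrite -[leRHS]mule1; apply: lee_wpmul2l => //.
      by rewrite lee_fin mulr_ge0 ?(ltW Cw_gt0) // divr_ge0 ?sigma_ge0.
    apply: (@le_trans _ _ (p t x y * (Cw * (s / sigma gamma1 gamma2 (k.+1%:R * t))))).
      by rewrite ler_wpM2l ?p_ge0.
    have hs : p t x y * (s / sigma gamma1 gamma2 t) <= C0 * p t' x y.
      by apply: le_trans (hk x y); rewrite ler_wpM2l ?p_ge0 // lerDr.
    have -> : p t x y * (Cw * (s / sigma gamma1 gamma2 (k.+1%:R * t))) =
      (Cw * (sigma gamma1 gamma2 t / sigma gamma1 gamma2 (k.+1%:R * t))) *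
      (p t x y * (s / sigma gamma1 gamma2 t)).
      by field; rewrite !gt_eqF ?sg.
    apply: (@le_trans _ _ ((Cw * (sigma gamma1 gamma2 t / sigma gamma1 gamma2 (k.+1%:R * t))) *
      (C0 * p t' x y))).
      by rewrite ler_wpM2l // mulr_ge0 ?(ltW Cw_gt0) // divr_ge0 ?sigma_ge0.
    rewrite /S (_ : maxn k.+1 1 = k.+1); last by apply/maxn_idPl.
    set q := sigma _ _ t / _.
    have q0 : 0 <= q by rewrite divr_ge0 ?sigma_ge0.
    have -> : Cw * q * (C0 * p t' x y) = C0 * Cw * q * p t' x y by ring.
    rewrite ler_wpM2r ?p_ge0 // ler_wpM2r // /D ler_wpM2l ?(ltW C00) //.
    by rewrite lerDr.
have tele : a 0%N - a n <= \sum_(k < n) S k * j.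
  elim: n {n0} => [|n IH]; first by rewrite big_ord0 subrr.
  rewrite big_ord_recr /=.
  have -> : a 0%N - a n.+1 = (a 0%N - a n) + (a n - a n.+1) by ring.
  exact: lerD.
have nt0 : 0 < n%:R * t by rewrite mulr_gt0 // ltr0n.
rewrite !crE // -/j -EFinM lee_fin.
have -> : L2dot mu \1_A \1_A = a 0%N.
  have L00 : L2 mu (P 0 \1_A) by apply: (heat_L2 hP).
  apply: L2dot_ae => //; first by rewrite mul0r.
    by rewrite mul0r; apply: filterS (heat_0 hP Lf) => x h /h ->.
  exact: nearW.
apply: (le_trans tele).
rewrite -mulr_suml ler_wpM2r // -/D.
set Psi := sigma (1 - gamma1) (1 - gamma2).
have /andP[g10 g11] := gamma1_01; have /andP[g20 g21] := gamma2_01.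
have sP : sigma gamma1 gamma2 t / t = (Psi t)^-1.
  have := sigma_compl gamma1 gamma2 t (ltW t0) g11 g21.
  rewrite -/Psi => {2}<-; rewrite invfM mulrA divff ?mul1r // gt_eqF //.
  exact: sg.
have sumle : \sum_(1 <= k < n.+1) (t / sigma gamma1 gamma2 (k%:R * t)) <=
    m^-1 * Psi (n%:R * t) by exact: sum_inv_sigma_le.
have T0 k : 0 <= t / sigma gamma1 gamma2 (k%:R * t).
  by rewrite divr_ge0 ?(ltW t0) // sigma_ge0.
have Sk k : S k = D * (Psi t)^-1 * (t / sigma gamma1 gamma2 ((maxn k 1)%:R * t)).
  by rewrite /S -sP; field; rewrite (gt_eqF t0) /= gt_eqF ?sg // mulr_gt0 // ltr0n leq_max orbT.
have DP0 : 0 <= D * (Psi t)^-1.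
  by rewrite mulr_ge0 ?(ltW D0) // invr_ge0 sigma_ge0.
under eq_bigr do rewrite Sk.
rewrite -mulr_sumr.
have -> : 2 * D / m * (Psi (n%:R * t) / Psi t) =
    D / Psi t * (m^-1 * Psi (n%:R * t) + m^-1 * Psi (n%:R * t)) by ring.
rewrite ler_wpM2l //.
case: n n0 sumle {tele nt0} => // n _ sumle.
rewrite big_ord_recl /=; apply: lerD.
  apply: le_trans sumle; rewrite big_ltn // lerDl.
  by apply: sumr_ge0 => k _.
apply: le_trans sumle; rewrite big_add1 /= big_mkord big_ord_recr /=.
by rewrite -[leLHS]addr0; apply: lerD.
Qed.

End crossing_iteration.

(** * Jumps and the coarea formula *)

Lemma integral_abs_ltr_sub {R : realType} (a b : R) :
  (\int[lebesgue_measure]_r (`|(r < a)%R%:R - (r < b)%R%:R|%R)%:E = `|a - b|%:E)%E.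
Proof.
wlog ab : a b / b <= a.
  move=> H; have [/H //|/ltW/H] := leP b a.
  rewrite distrC => <-; apply: eq_integral => r _; by rewrite distrC.
transitivity (\int[lebesgue_measure]_r (\1_(`[b, a[%classic : set R) r)%:E)%E.
  apply: eq_integral => r _; congr EFin; rewrite indicE mem_setE in_itv /=.
  have [rb|br] := ltP r b.
    by rewrite (lt_le_trans rb ab) subrr normr0.
  by rewrite subr0; case: (r < a); rewrite ?normr1 ?normr0.
rewrite integral_indic // setIT; apply: etrans (lebesgue_measure_itv _) _.
rewrite /= lte_fin.
rewrite ger0_norm ?subr_ge0 //; case: ltP => [_|ab']; first by rewrite EFinB.
by rewrite (@le_anti _ _ a b) ?subrr // ab ab'.
Qed.

(** Up to the factor 1 / h(t), the Besov quotient of the indicator of [A]; it makes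
    sense and is symmetric under complement even if [A] has infinite measure. *)
Definition jump {d : measure_display} {R : realType}
    {X : borelCompleteMetricType d R}
    (mu : {sigma_finite_measure set X -> \bar R}) (p : R -> X -> X -> R) (t : R)
    (A : set X) : \bar R :=
  (\int[mu \x mu]_z (`|\1_A z.2 - \1_A z.1| * p t z.1 z.2)%:E)%E.

Section jump_theory.
Context {R : realType} {d : measure_display} {X : borelCompleteMetricType d R}.
Variable mu : {sigma_finite_measure set X -> \bar R}.
Variable p : R -> X -> X -> R.
Hypothesis mp : forall t, 0 < t ->
  measurable_fun [set: X * X] (fun z => p t z.1 z.2).
Hypothesis p_ge0 : forall t x y, 0 < t -> 0 <= p t x y.
Implicit Types (t : R) (A : set X).

Let mswap t : 0 < t -> measurable_fun [set: X * X] (fun z => p t z.2 z.1).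
Proof.
move=> t0; apply: (measurableT_comp (mp t t0) (g := fun z : X * X => (z.2, z.1))).
exact: measurable_fun_pair.
Qed.

Let mi1 A : measurable A -> measurable_fun [set: X * X] (fun z => \1_A z.1 : R).
Proof. by move=> mA; exact: measurableT_comp. Qed.

Let mi2 A : measurable A -> measurable_fun [set: X * X] (fun z => \1_A z.2 : R).
Proof. by move=> mA; exact: measurableT_comp. Qed.

Let mcross := measurable_crossing p mp.

Let mcross' t A : 0 < t -> measurable A ->
  measurable_fun [set: X * X]
    (fun z => (\1_A z.2 * (\1_(~` A) z.1 * p t z.2 z.1))%:E).
Proof.
move=> t0 mA; have mAc := measurableC mA; apply/measurable_EFinP.
by apply: measurable_funM; [exact: mi2|apply: measurable_funM; [exact: mi1|exact: mswap]].
Qed.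

Let mjump t A : 0 < t -> measurable A ->
  measurable_fun [set: X * X]
    (fun z => (`|\1_A z.2 - \1_A z.1| * p t z.1 z.2)%:E).
Proof.
move=> t0 mA; apply/measurable_EFinP; apply: measurable_funM; last exact: mp.
by apply: measurableT_comp => //; apply: measurable_funB; [exact: mi2|exact: mi1].
Qed.

Let cross0 t A x y : 0 < t -> 0 <= \1_A x * (\1_(~` A) y * p t x y).
Proof. by move=> t0; rewrite !mulr_ge0 ?p_ge0 // indicE. Qed.

Lemma crossing_prod t A : 0 < t -> measurable A ->
  (crossing mu p t A =
   \int[mu \x mu]_z (\1_A z.1 * (\1_(~` A) z.2 * p t z.1 z.2))%:E)%E.
Proof.
move=> t0 mA; rewrite fubini_tonelli1 //; first exact: mcross.
by move=> z; rewrite lee_fin cross0.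
Qed.

Lemma crossing_prod_swap t A : 0 < t -> measurable A ->
  (crossing mu p t A =
   \int[mu \x mu]_z (\1_A z.2 * (\1_(~` A) z.1 * p t z.2 z.1))%:E)%E.
Proof.
move=> t0 mA; rewrite fubini_tonelli2 //; first exact: mcross'.
by move=> z; rewrite lee_fin cross0.
Qed.

Lemma crossing_le_jump t A : 0 < t -> measurable A ->
  (crossing mu p t A <= jump mu p t A)%E.
Proof.
move=> t0 mA; rewrite crossing_prod //; apply: ge0_le_integral => //.
- by move=> z _; rewrite lee_fin cross0.
- exact: mcross.
- exact: mjump.
- move=> z _; rewrite lee_fin mulrA ler_wpM2r ?p_ge0 // !indicE in_setC.
  by case: (z.1 \in A); case: (z.2 \in A) => /=;
    rewrite ?mul0r ?mulr0 ?mulr1 // sub0r normrN normr1.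
Qed.

(** The jumps into [A] are turned into jumps out of [A] by exchanging the two
    variables; the comparison at a later time makes up for the kernel being
    symmetric only almost everywhere. *)
Lemma jump_le_crossing t t' A C : 0 < t -> 0 < t' -> 0 <= C -> measurable A ->
    (forall x y, p t x y <= C * p t' x y) ->
    (forall x y, p t x y <= C * p t' y x) ->
  (jump mu p t A <= (2 * C)%:E * crossing mu p t' A)%E.
Proof.
move=> t0 t'0 C0 mA h h'.
have -> : ((2 * C)%:E * crossing mu p t' A =
    \int[mu \x mu]_z (C%:E * ((\1_A z.1 * (\1_(~` A) z.2 * p t' z.1 z.2))%:E +
      (\1_A z.2 * (\1_(~` A) z.1 * p t' z.2 z.1))%:E)))%E.
  rewrite ge0_integralZl //; last 2 first.
  - by apply: emeasurable_funD; [exact: mcross|exact: mcross'].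
  - by move=> z _; rewrite -EFinD lee_fin addr_ge0 // cross0.
  rewrite ge0_integralD //.
  - rewrite -crossing_prod // -crossing_prod_swap //.
    by rewrite mulrC EFinM -muleA mule_natl mule2n.
  - by move=> z _; rewrite lee_fin cross0.
  - exact: mcross.
  - by move=> z _; rewrite lee_fin cross0.
  - exact: mcross'.
apply: ge0_le_integral => //.
- by move=> z _; rewrite lee_fin mulr_ge0 ?p_ge0.
- exact: mjump.
- apply: measurable_funeM.
  by apply: emeasurable_funD; [exact: mcross|exact: mcross'].
- move=> z _; rewrite -EFinD -EFinM lee_fin !indicE !in_setC.
  have := h z.1 z.2; have := h' z.1 z.2.
  case: (z.1 \in A); case: (z.2 \in A) => /=;
    rewrite ?subrr ?sub0r ?subr0 ?normrN ?normr0 ?normr1; lra.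
Qed.

Lemma jumpC t A : jump mu p t (~` A) = jump mu p t A.
Proof.
apply: eq_integral => z _; congr EFin; congr (_ * _); rewrite !indicE !in_setC.
by case: (z.1 \in A); case: (z.2 \in A) => //=; rewrite ?subrr // distrC.
Qed.

Section coarea.
Variables (f : X -> R) (t : R).
Hypotheses (mf : measurable_fun setT f) (t0 : 0 < t).

Let level r := [set x | r < f x].
Let G y x r : \bar R := (`|\1_(level r) x - \1_(level r) y| * p t y x)%:E.

Let mlevel d' (T : measurableType d') (h : T -> X) (k : T -> R) :
    measurable_fun setT h -> measurable_fun setT k ->
  measurable_fun setT (fun w => \1_(level (k w)) (h w) : R).
Proof.
move=> mh mk; pose S := [set w | k w < f (h w)].
have mkf : measurable_fun setT (fun w => k w < f (h w)).
  by apply: measurable_fun_ltr => //; exact: measurableT_comp.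
have mS : measurable S.
  by have := mkf measurableT [set true] I; rewrite setTI.
rewrite (_ : (fun w => _) = \1_S); first exact: measurable_indic.
by apply/funext => w; rewrite !indicE.
Qed.

Let mG d' (T : measurableType d') (hy hx : T -> X) (k : T -> R) :
    measurable_fun setT hy -> measurable_fun setT hx -> measurable_fun setT k ->
  measurable_fun setT (fun w => G (hy w) (hx w) (k w)).
Proof.
move=> mhy mhx mk; apply/measurable_EFinP; apply: measurable_funM.
  by apply: measurableT_comp => //; apply: measurable_funB; exact: mlevel.
apply: (measurableT_comp (mp t t0) (g := fun w => (hy w, hx w))).
exact: measurable_fun_pair.
Qed.

Let G0 y x r : (0 <= G y x r)%E.
Proof. by rewrite lee_fin mulr_ge0 ?p_ge0. Qed.

Let H (w : X * R) := (\int[mu]_x G w.1 x w.2)%E.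

Let mH : measurable_fun setT H.
Proof.
apply: (measurable_fun_fubini_tonelli_F (m2 := mu)
  (fun v : (X * R) * X => G v.1.1 v.2 v.1.2)) => [|v]; last exact: G0.
apply: mG => //.
- exact: (measurableT_comp measurable_fst measurable_fst).
- exact: (measurableT_comp measurable_snd measurable_fst).
Qed.

Let H0 w : (0 <= H w)%E.
Proof. by apply: integral_ge0 => x _; exact: G0. Qed.

Let mlevel_set r : measurable (level r).
Proof.
rewrite -[level r]setTI.
by have /(_ measurableT [set true] I) := measurable_fun_ltr (@measurable_cst _ _ _ _ setT r) mf.
Qed.

Let jumpE r : jump mu p t (level r) = (\int[mu]_y H (y, r))%E.
Proof.
rewrite /jump fubini_tonelli1 //; first exact: mjump.
by move=> z; rewrite lee_fin mulr_ge0 ?p_ge0.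
Qed.

Lemma measurable_jump_level : measurable_fun setT (fun r => jump mu p t (level r)).
Proof.
under eq_fun do rewrite jumpE.
exact: (measurable_fun_fubini_tonelli_G (m1 := mu) H mH H0).
Qed.

(** Coarea formula: |f(x) - f(y)| is the integral over the levels r of
    |1_(f>r)(x) - 1_(f>r)(y)|, and Tonelli's theorem exchanges the integrals, one
    space variable at a time. *)
Lemma jump_coarea :
  (\int[mu]_y \int[mu]_x (`|f x - f y| * p t y x)%:E =
   \int[lebesgue_measure]_r jump mu p t (level r))%E.
Proof.
under [RHS]eq_integral do rewrite jumpE.
have := fubini_tonelli (m1 := mu) (m2 := lebesgue_measure) H mH H0.
move=> <-; apply: eq_integral => y _; rewrite /H /=.
have mGy : measurable_fun [set: X * R] (fun w : X * R => G y w.1 w.2).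
  apply: (mG _ _ (cst y) fst snd) => //.
have := fubini_tonelli (m1 := mu) (m2 := lebesgue_measure)
  (fun w => G y w.1 w.2) mGy (fun w => G0 y w.1 w.2).
move=> <-; apply: eq_integral => x _ /=; rewrite /G.
under [RHS]eq_integral do rewrite EFinM.
rewrite ge0_integralZr ?lee_fin ?p_ge0 //.
- rewrite EFinM -integral_abs_ltr_sub; congr (_ * _)%E.
  by apply: eq_integral => r _; rewrite !indicE !mem_setE.
- apply/measurable_EFinP; apply: measurableT_comp => //.
  by apply: measurable_funB; apply: (mlevel _ _ (cst _) id).
Qed.

End coarea.
End jump_theory.

(** * Finiteness of measures *)

Section sigma_finite_measure_of.
Context {d : measure_display} {T : measurableType d} {R : realType}.
Variable mu : {measure set T -> \bar R}.

(** An alias of [mu] that carries the structure of a sigma-finite measure, as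
    Tonelli's theorem is stated for such structures. *)
Definition measure_of_sigma_finite (_ : sigma_finite setT mu) : set T -> \bar R :=
  mu.

Variable sf : sigma_finite setT mu.

HB.instance Definition _ := Measure.copy (measure_of_sigma_finite sf) mu.
HB.instance Definition _ :=
  Measure_isSigmaFinite.Build d T R (measure_of_sigma_finite sf) sf.

End sigma_finite_measure_of.

Lemma sigma_finite_measureP {d : measure_display} {T : measurableType d}
    {R : realType} (mu : {measure set T -> \bar R}) : sigma_finite setT mu ->
  exists nu : {sigma_finite_measure set T -> \bar R},
    (nu : {measure set T -> \bar R}) = mu.
Proof.
move=> sf; exists (measure_of_sigma_finite mu sf : {sigma_finite_measure set T -> \bar R}).
by case: mu sf => mu [].
Qed.

Lemma metric_ball_open {R : realType} {X : metricType R} (x : X) (r : R) :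
  open (ball x r).
Proof.
rewrite openE => y; rewrite {1}ballEmdist /= => xy.
rewrite /interior; apply/nbhs_ballP; exists (r - mdist x y) => /=.
  by rewrite subr_gt0.
move=> z; rewrite !ballEmdist /= => yz.
by rewrite (le_lt_trans (metric_triangle x y z)) // -ltrBrDl.
Qed.

Lemma volume_growth_sigma_finite {d : measure_display} {R : realType}
    {X : borelCompleteMetricType d R} (mu : {measure set X -> \bar R})
    (alpha1 alpha2 : R) :
  volume_growth mu alpha1 alpha2 -> sigma_finite setT mu.
Proof.
move=> [C _ hC].
have [[x0 _]|X0] := pselect (exists x : X, True); last first.
  exists (fun=> set0) => [|n]; last by rewrite measure0.
  by rewrite predeqE => x; exfalso; apply: X0; exists x.
exists (fun n => ball x0 n.+1%:R) => [|n].
  rewrite predeqE => x; split => // _.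
  exists (Num.trunc (mdist x0 x)) => //=.
  by rewrite ballEmdist /=; exact: truncnS_gt.
split.
  rewrite measurable_borel; apply: sub_sigma_algebra.
  exact: metric_ball_open.
have [//|_ h] := hC x0 n.+1%:R.
by apply: le_lt_trans h _; rewrite ltry.
Qed.

Lemma ge_abs_level_finite {d : measure_display} {T : measurableType d}
    {R : realType} (mu : {measure set T -> \bar R}) (f : T -> R) (a : R) :
  mu.-integrable setT (EFin \o f) -> 0 < a ->
  (mu [set x | (a <= `|f x|)%R] < +oo)%E.
Proof.
move=> /integrableP[mf foo] a0.
have := le_integral_abse mu measurableT mf a0; rewrite setTI.
move=> /le_lt_trans /(_ foo).
case: (mu _) => [r|/=|//]; first by move=> _; rewrite ltry.
by rewrite gt0_muley // lte_fin.
Qed.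

(** * Comparison of the Besov quotients at different times *)

Section jump_scaling.
Context {R : realType} {d : measure_display} {X : borelCompleteMetricType d R}.
Variable mu : {sigma_finite_measure set X -> \bar R}.
Variables (E : (X -> R) -> (X -> R) -> R) (F : set (X -> R)).
Variables (P : R -> (X -> R) -> (X -> R)) (p : R -> X -> X -> R).
Hypothesis hP : heat_semigroup mu E F P.
Hypothesis hp : heat_kernel mu P p.
Hypothesis p_conservative : conservative mu p.
Variables (alpha1 alpha2 beta1 beta2 kappa1 kappa2 : R).
Hypotheses (alpha1_gt0 : 0 < alpha1) (alpha2_gt0 : 0 < alpha2).
Hypotheses (beta1_gt1 : 1 < beta1) (beta2_gt1 : 1 < beta2).
Hypotheses (hkappa1 : 0 < kappa1 < beta1) (hkappa2 : 0 < kappa2 < beta2).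
Hypothesis hest : heat_kernel_estimates p alpha1 alpha2 beta1 beta2.
Hypothesis hwBE : wBE mu p beta1 beta2 kappa1 kappa2.

Local Notation gamma1 := (kappa1 / beta1).
Local Notation gamma2 := (kappa2 / beta2).
Let Psi := sigma (1 - gamma1) (1 - gamma2).

Let gamma1_01 : 0 < gamma1 < 1.
Proof.
have b0 := lt_trans ltr01 beta1_gt1; case/andP: hkappa1 => k0 kb.
by rewrite divr_gt0 //= ltr_pdivrMr // mul1r.
Qed.

Let gamma2_01 : 0 < gamma2 < 1.
Proof.
have b0 := lt_trans ltr01 beta2_gt1; case/andP: hkappa2 => k0 kb.
by rewrite divr_gt0 //= ltr_pdivrMr // mul1r.
Qed.

Let Psi_gt0 t : 0 < t -> 0 < Psi t. Proof. exact: sigma_gt0. Qed.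

Lemma heat_kernel_ge0 t x y : 0 < t -> 0 <= p t x y.
Proof.
move=> t0; have [_ [C [c [C0 c0 h]]]] := hest.
apply: le_trans (h x y t t0).
by rewrite mulr_ge0 ?expR_ge0 // divr_ge0 ?(ltW C0) // sigma_ge0.
Qed.

(** The two-sided estimates only see the distance, so that the comparison also
    holds with the two points exchanged. *)
Lemma heat_kernel_compare : exists2 l : R, 1 <= l & exists2 C : R, 0 < C &
  forall t t' x y, 0 < t -> l * t <= t' <= 2 * l * t ->
    let K := p t x y *
      (1 + sigma kappa1 kappa2 (mdist x y) / sigma gamma1 gamma2 t) in
    K <= C * p t' x y /\ K <= C * p t' y x.
Proof.
have [[C1 [c1 [C10 c10 h1]]] [C2 [c2 [C20 c20 h2]]]] := hest.
have [l l1 [C C0 hC]] := subgaussian_compare alpha1 alpha2 beta1 beta2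
  alpha1_gt0 alpha2_gt0 beta1_gt1 beta2_gt1 kappa1 kappa2 C1 c1 C2 c2
  hkappa1 hkappa2 C10 c10 C20 c20.
exists l => //; exists C => // t t' x y t0 tt' K.
have t'0 : 0 < t'.
  case/andP: tt' => ltt' _; apply: lt_le_trans ltt'.
  by rewrite mulr_gt0 // (lt_le_trans ltr01).
have hK : K <= C * subgaussian alpha1 alpha2 beta1 beta2 C2 c2 t' (mdist x y).
  apply: le_trans (hC t t' _ t0 tt' (mdist_ge0 _ _)).
  rewrite ler_wpM2r ?h1 // addr_ge0 // divr_ge0 ?sigma_ge0 //.
split; apply: (le_trans hK); rewrite ler_wpM2l ?(ltW C0) ?h2 //.
by rewrite metric_sym h2.
Qed.

(** The estimate of the theorem for indicators, between any two times s <= t. With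
    the small step u = s / l and n u between l t and 2 l t, the jumps at time t are
    controlled by the mass crossing at time n u, hence after iteration by the mass
    crossing at time l u = s. *)
Lemma jump_scaling : exists2 C : R, 0 < C & forall s t A, 0 < s <= t ->
  measurable A -> (mu A < +oo)%E ->
  (jump mu p t A <= (C * (Psi t / Psi s))%:E * jump mu p s A)%E.
Proof.
have [l l1 [C0 C00 hC]] := heat_kernel_compare.
have [Cw Cw0 hw] := hwBE.
have /andP[g10 g11] := gamma1_01; have /andP[g20 g21] := gamma2_01.
pose m := Num.min (1 - gamma1) (1 - gamma2).
have m0 : 0 < m by rewrite lt_min !subr_gt0 g11.
have l0 : 0 < l by exact: lt_le_trans l1.
pose K := 2 * (C0 * (1 + Cw)) / m.
have K0 : 0 < K by rewrite divr_gt0 // !mulr_gt0 // addr_gt0.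
have ll0 : 0 < 2 * l * l by rewrite !mulr_gt0.
exists (2 * C0 * (K * (2 * l * l))).
  by rewrite (mulr_gt0 _ (mulr_gt0 K0 ll0)) // mulr_gt0.
move=> s t A /andP[s0 st] mA Aoo.
have t0 : 0 < t by exact: lt_le_trans st.
pose u := s / l.
have u0 : 0 < u by rewrite divr_gt0.
have lu : l * u = s by rewrite /u mulrC divfK // gt_eqF.
pose n := (Num.trunc (l * t / u)).+1.
have lt0 : 0 <= l * t / u by rewrite divr_ge0 ?(ltW u0) // mulr_ge0 // ltW.
have /andP[nle ngt] := truncn_itv lt0.
have ltnu : l * t <= n%:R * u by rewrite -ler_pdivrMr // ltW.
have us : u <= s by rewrite -lu ler_peMl // ltW.
have nule : n%:R * u <= 2 * l * t.
  rewrite /n -natr1 mulrDl mul1r.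
  have : (Num.trunc (l * t / u))%:R * u <= l * t by rewrite -ler_pdivlMr.
  have : u <= l * t.
    by apply: (le_trans us); apply: (le_trans st); rewrite ler_peMl // ltW.
  lra.
have nu0 : 0 < n%:R * u by rewrite mulr_gt0.
have pge0 := heat_kernel_ge0.
have mp r (r0 : 0 < r) := measurable_heat_kernel mu P p hp r r0.
have fac r x y : 0 < r -> p r x y <= p r x y *
    (1 + sigma kappa1 kappa2 (mdist x y) / sigma gamma1 gamma2 r).
  by move=> r0; rewrite ler_peMr ?pge0 // lerDl divr_ge0 ?sigma_ge0.
have hnu : l * t <= n%:R * u <= 2 * l * t by rewrite ltnu.
have s2 : l * u <= s <= 2 * l * u.
  by rewrite lu lexx -mulrA lu ler_peMl ?ler1n // ltW.
have step1 : (jump mu p t A <= (2 * C0)%:E * crossing mu p (n%:R * u) A)%E.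
  apply: (jump_le_crossing mu p mp pge0 t _ A C0 t0 nu0 (ltW C00) mA).
    by move=> x y; apply: le_trans (fac t x y t0) _; have [] := hC t _ x y t0 hnu.
  by move=> x y; apply: le_trans (fac t x y t0) _; have [] := hC t _ x y t0 hnu.
have step2 : (crossing mu p (n%:R * u) A <=
    (K * (Psi (n%:R * u) / Psi u))%:E * crossing mu p s A)%E.
  apply: (crossing_iter_le mu E F P p hP hp p_conservative pge0
    beta1 beta2 kappa1 kappa2 m Cw) => //.
  - by rewrite /m ge_min lexx.
  - by rewrite /m ge_min lexx orbT.
  - by move=> x y; have [] := hC u s x y u0 s2.
have PsiM v w r : 0 < w -> 1 <= r -> v <= r * w -> 0 <= v -> Psi v <= r * Psi w.
  move=> w0 r1 vw v0; apply: (@le_trans _ _ (Psi (r * w))).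
    by apply: sigma_homo => //; rewrite subr_ge0 ltW.
  have := sigma_scale_le (1 - gamma1) (1 - gamma2) 1 r w.
  rewrite !subr_ge0 !gerBl !(ltW g10, ltW g20, ltW g11, ltW g21).
  move=> /(_ isT isT r1 (ltW w0)); rewrite powRr1 //.
  exact: le_trans r1.
have ll1 : 1 <= 2 * l by lra.
have Pnu : Psi (n%:R * u) <= 2 * l * Psi t by apply: PsiM => //; exact: ltW.
have Psu : Psi s <= l * Psi u by apply: PsiM; rewrite ?lu // ltW.
have Pratio : Psi (n%:R * u) / Psi u <= 2 * l * l * (Psi t / Psi s).
  have Pu := Psi_gt0 u u0; have Ps := Psi_gt0 s s0.
  rewrite ler_pdivrMr //; apply: (le_trans Pnu).
  have -> : 2 * l * l * (Psi t / Psi s) * Psi u =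
    2 * l * Psi t * (l * Psi u / Psi s) by ring.
  rewrite ler_peMr ?mulr_ge0 ?(ltW l0) ?sigma_ge0 //.
  by rewrite ler_pdivlMr // mul1r.
have jp0 : (0 <= jump mu p s A)%E.
  by apply: integral_ge0 => z _; rewrite lee_fin mulr_ge0 ?pge0.
apply: (le_trans step1).
apply: (@le_trans _ _ ((2 * C0)%:E * ((K * (Psi (n%:R * u) / Psi u))%:E * jump mu p s A))%E).
  apply: lee_wpmul2l; first by rewrite lee_fin mulr_ge0 // ltW.
  apply: (le_trans step2); apply: lee_wpmul2l.
    by rewrite lee_fin mulr_ge0 ?(ltW K0) // divr_ge0 ?sigma_ge0.
  exact: crossing_le_jump.
rewrite muleA -EFinM lee_wpmul2r // lee_fin -[leRHS]mulrA -[in leRHS](mulrA K).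
rewrite ler_wpM2l //; first by rewrite mulr_ge0 // ltW.
by rewrite ler_wpM2l // ltW.
Qed.

(** The indicator estimate integrated over the levels of [f]. For r > 0 the set
    {f > r} has finite measure, for r < 0 its complement has, and the level r = 0
    is negligible. *)
Lemma besov_quotient_le : exists2 C : R, 0 < C & forall s t f, 0 < s <= t ->
  f \in Lfun mu 1 ->
  (besov_quotient mu p Psi f t <= C%:E * besov_quotient mu p Psi f s)%E.
Proof.
have [C C0 hC] := jump_scaling; exists C => // s t f st Lf.
have [s0 t0] : 0 < s /\ 0 < t.
  by case/andP: st => s0 st; split => //; exact: lt_le_trans st.
have intf := (Lfun1_integrable mu f).1 Lf.
have mf : measurable_fun setT f by apply/measurable_EFinP; exact: measurable_int intf.
have pge0 := heat_kernel_ge0.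
have mp r (r0 : 0 < r) := measurable_heat_kernel mu P p hp r r0.
have j0 v A : 0 < v -> (0 <= jump mu p v A)%E.
  by move=> v0; apply: integral_ge0 => z _; rewrite lee_fin mulr_ge0 ?pge0.
rewrite /besov_quotient !(jump_coarea mu p mp pge0 f) //.
have mj v (v0 : 0 < v) := measurable_jump_level mu p mp pge0 f v mf v0.
have Pt := Psi_gt0 t t0; have Ps := Psi_gt0 s s0.
set Is := (\int[lebesgue_measure]_r jump mu p s _)%E.
have -> : (C%:E * (((Psi s)^-1)%:E * Is) =
    ((Psi t)^-1)%:E * ((C * (Psi t / Psi s))%:E * Is))%E.
  rewrite !muleA -!EFinM; congr (_%:E * _)%E.
  by field; rewrite !gt_eqF.
apply: lee_wpmul2l; first by rewrite lee_fin invr_ge0 ltW.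
have c0 : 0 <= C * (Psi t / Psi s) by rewrite mulr_ge0 ?divr_ge0 // ltW.
rewrite /Is -ge0_integralZl //; [|exact: mj|by move=> r _; exact: j0].
apply: ae_ge0_le_integral => //.
- by move=> r _; exact: j0.
- exact: mj.
- by move=> r _; apply: mule_ge0 => //; exact: j0.
- by apply: measurable_funeM; exact: mj.
exists [set 0]; split; [exact: measurable_set1|exact: lebesgue_measure_set1|].
move=> r /= h; apply: contrapT => r0; apply: h => _.
have mlevel : measurable [set x | r < f x].
  have := measurable_fun_ltr (@measurable_cst _ _ _ _ setT r) mf.
  by move=> /(_ measurableT [set true] I); rewrite setTI.
have absr0 : 0 < `|r| by rewrite normr_gt0; apply/eqP.
have fin := ge_abs_level_finite mu f `|r| intf absr0.
have mabs : measurable [set x | `|r| <= `|f x|].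
  have mnf : measurable_fun setT (fun x => `|f x|) by exact: measurableT_comp.
  have := measurable_fun_ler (@measurable_cst _ _ _ _ setT `|r|) mnf.
  by move=> /(_ measurableT [set true] I); rewrite setTI.
have [r_gt0|r_le0] := ltP 0 r.
  apply: hC => //; apply: le_lt_trans fin; apply: le_measure; rewrite ?inE //.
  move=> x /= rx; rewrite gtr0_norm // ger0_norm ?ltW //.
  exact: lt_trans rx.
rewrite -jumpC -[in leRHS]jumpC; apply: hC => //; first exact: measurableC.
apply: le_lt_trans fin; apply: le_measure; rewrite ?inE //.
  exact: measurableC.
move=> x /= /negP; rewrite -leNgt => fr.
by rewrite !ler0_norm ?lerN2 // (le_trans fr).
Qed.

End jump_scaling.

Theorem theorem4p1 (R : realType) (d : measure_display)
  (X : borelCompleteMetricType d R)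
  (hX : locally_compact [set: X])
  (mu : {measure set X -> \bar R})
  (mu_radon : radon_measure mu)
  (mu_doubling : doubling_positive mu)
  (E : (X -> R) -> (X -> R) -> R) (F : set (X -> R))
  (hE : dirichlet_form mu E F)
  (P : R -> (X -> R) -> (X -> R))
  (hP : heat_semigroup mu E F P)
  (p : R -> X -> X -> R)
  (hp : heat_kernel mu P p)
  (p_conservative : conservative mu p)
  (alpha1 alpha2 : R) (alpha1_ge1 : 1 <= alpha1) (alpha2_ge1 : 1 <= alpha2)
  (hvol : volume_growth mu alpha1 alpha2)
  (beta1 beta2 : R)
  (hbeta1 : 2 <= beta1 <= 1 + alpha1) (hbeta2 : 2 <= beta2 <= 1 + alpha2)
  (hest : heat_kernel_estimates p alpha1 alpha2 beta1 beta2)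
  (kappa1 kappa2 : R)
  (hkappa1 : 0 < kappa1 < beta1) (hkappa2 : 0 < kappa2 < beta2)
  (hwBE : wBE mu p beta1 beta2 kappa1 kappa2) :
  let Psi1 := sigma (1 - kappa1 / beta1) (1 - kappa2 / beta2) in
  exists2 C : R, 0 < C & forall f : X -> R, besov_class mu p Psi1 f ->
    (besov_seminorm mu p Psi1 f <=
     C%:E * limf_einf (besov_quotient mu p Psi1 f) 0^'+)%E.
Proof.
move=> Psi1.
have [nu nuE] := sigma_finite_measureP mu (volume_growth_sigma_finite mu _ _ hvol).
have a1 : 0 < alpha1 by exact: lt_le_trans alpha1_ge1.
have a2 : 0 < alpha2 by exact: lt_le_trans alpha2_ge1.
have b1 : 1 < beta1 by case/andP: hbeta1 => h _; lra.
have b2 : 1 < beta2 by case/andP: hbeta2 => h _; lra.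
move: hP hp p_conservative hwBE; rewrite -nuE => hP' hp' hc' hw'.
have [C C0 hC] := besov_quotient_le nu E F P p hP' hp' hc' alpha1 alpha2
  beta1 beta2 kappa1 kappa2 a1 a2 b1 b2 hkappa1 hkappa2 hest hw'.
exists C => // f [Lf _].
apply: ge_ereal_sup => _ [t /= t0 <-].
rewrite -lee_pdivrMl //.
rewrite limf_einfE; apply: le_ereal_sup_tmp.
exists (ereal_inf [set besov_quotient nu p Psi1 f s | s in [set s | 0 < s <= t]]).
  exists [set s | 0 < s <= t] => //.
  near=> s; rewrite /=; apply/andP; split => //.
  by near: s; exact: nbhs_right_le.
apply: le_ereal_inf_tmp => _ [s /= st <-].
by rewrite lee_pdivrMl //; exact: hC.
Unshelve. all: by end_near. Qed.
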